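(* Let $k$ be a field of characteristic zero, $m\in\{1,\dots,n\}$, $f_1,\dots,f_m\in k[x_1,\dots,x_n]$ arbitrary, and $g\in k[x_1,\dots,x_n]$ irreducible. The following are equivalent: (i) $g\mid\mathrm{dgcd}(f_1,\dots,f_m)$; (ii) $g^2\mid w(f_1,\dots,f_m)$ for some irreducible polynomial $w\in k[x_1,\dots,x_m]$; (iii) $g^2\mid w(f_1,\dots,f_m)$ for some square-free polynomial $w\in k[x_1,\dots,x_m]$.
   Context: For $f_1,\dots,f_m\in k[x_1,\dots,x_n]$ ($m\le n$), $\mathrm{dgcd}(f_1,\dots,f_m)=\gcd\big(\det(\partial f_a/\partial x_{i_b})_{a,b=1}^m : 1\le i_1<\dots<i_m\le n\big)$, defined up to a nonzero constant factor, and equal to $0$ if all these Jacobian determinants vanish. An element $a$ of a commutative ring $R$ is square-free if it cannot be written as $a=b^2c$ with $b,c\in R$ and $b$ not a unit of $R$. *)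

(* Defs.v *)
(* Multivariate polynomials k[x_0,...,x_{n-1}] are modelled as
   iterated univariate polynomials: mpoly R 0 = R, mpoly R n.+1 = {poly mpoly R n}
   (the outermost variable of mpoly R n.+1 is x_n). *)
From HB Require Import structures.
From mathcomp Require Import all_boot all_order all_algebra.
Set Implicit Arguments. Unset Strict Implicit. Unset Printing Implicit Defensive.
Import Order.TTheory GRing.Theory Num.Theory.
Local Open Scope ring_scope.

Fixpoint mpoly (R : idomainType) (n : nat) : idomainType :=
  if n is n'.+1 then ({poly mpoly R n'} : idomainType) else R.

Fixpoint mconst (R : idomainType) (n : nat) : R -> mpoly R n :=
  if n is n'.+1 return R -> mpoly R n then fun c => (mconst n' c)%:P
  else fun c => c.

(* the variable x_i (i < n) in mpoly R n; 0 if i >= n *)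
Fixpoint mX (R : idomainType) (n : nat) (i : nat) : mpoly R n :=
  if n is n'.+1 return mpoly R n then
    (if i == n' then 'X else (mX R n' i)%:P)
  else 0.

Fixpoint mderiv (R : idomainType) (n : nat) (i : nat) : mpoly R n -> mpoly R n :=
  if n is n'.+1 return mpoly R n -> mpoly R n then
    (fun p : {poly mpoly R n'} =>
       if i == n' then deriv p else map_poly (mderiv i) p)
  else fun _ => 0.

Fixpoint meval (R : idomainType) (n m : nat) (fs : nat -> mpoly R n)
  : mpoly R m -> mpoly R n :=
  if m is m'.+1 return mpoly R m -> mpoly R n then
    (fun w : {poly mpoly R m'} => (map_poly (meval fs) w).[fs m'])
  else fun c => mconst n c.

Definition mcomp (R : idomainType) (n m : nat) (f : 'I_m -> mpoly R n)
  (w : mpoly R m) : mpoly R n :=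
  meval (fun i : nat => if insub i is Some j then f j else 0) w.

Definition rdvd (R : comPzRingType) (a b : R) : Prop := exists c : R, b = c * a.

Definition irreducible_elt (R : comUnitRingType) (a : R) : Prop :=
  a != 0 /\ a \isn't a GRing.unit /\
  forall b c : R, a = b * c -> b \is a GRing.unit \/ c \is a GRing.unit.

Definition squarefree_elt (R : comUnitRingType) (a : R) : Prop :=
  ~ exists b c : R, a = b ^+ 2 * c /\ b \isn't a GRing.unit.

Definition is_gcd_of (R : comPzRingType) (P : R -> Prop) (d : R) : Prop :=
  (forall x, P x -> rdvd d x) /\
  (forall e, (forall x, P x -> rdvd e x) -> rdvd e d).

Definition jac_minor (R : idomainType) (n m : nat) (f : 'I_m -> mpoly R n)
  (s : 'I_m -> 'I_n) : mpoly R n :=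
  \det (\matrix_(a < m, b < m) mderiv (s b) (f a)).

Definition is_jac_minor (R : idomainType) (n m : nat) (f : 'I_m -> mpoly R n)
  (h : mpoly R n) : Prop :=
  exists s : 'I_m -> 'I_n,
    (forall a b : 'I_m, (a < b)%N -> (s a < s b)%N) /\ h = jac_minor f s.

Definition is_dgcd (R : idomainType) (n m : nat) (f : 'I_m -> mpoly R n)
  (d : mpoly R n) : Prop := is_gcd_of (is_jac_minor f) d.

(* Main.v *)
(** Let L be the fraction field of k[x]/(g) and P the prime ideal of the polynomials
    w in k[y_1, ..., y_m] such that g divides w(f).  For a in k[x] write grad a for
    the gradient of a, read in L^n.

    Differentiating a relation of minimal degree (characteristic zero) shows that the
    gradient of an element algebraic over a family s in L lies in the span of grad g
    and of the gradients of s.  Extending an independent family s by variables, this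
    span becomes all of L^n, while the extended family has at most n - 1 elements
    because L has transcendence degree < n; hence grad g and grad s are linearly
    independent for every algebraically independent s.

    If the minors vanish modulo g, then P is nonzero.  If P = (p), then m - 1 of the
    f_i are independent in L; writing p(f) = h g, the relation
    sum_a (d_a p)(f) grad f_a = h grad g would make the gradients of the f_i
    independent unless g | h, so g^2 | p(f).  If P is not principal, it contains an
    irreducible c free of the last variable t and some d not divisible by c; for a
    prime l | 1 + c and large N, the polynomial
    c^2 (t^N + l) + (1 - c^2) t^2 d^2 is irreducible by Eisenstein's criterion at l,
    and it lies in P^2.

    Conversely let w be square-free with g^2 | w(f) and suppose that the gradients of
    the f_i are independent in L^n.  Then all d_a w lie in P.  A nonprincipal P would
    force the span of grad g and of the grad f_i to have dimension < m, so P = (p), and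
    w = p w' with p | w' d_a p for all a, whence p^2 | w. *)

Require Import Defs.
From HB Require Import structures.
From mathcomp Require Import all_boot all_order all_algebra.
From mathcomp Require Import boolp ring zify ring_quotient fraction.
Set Implicit Arguments. Unset Strict Implicit. Unset Printing Implicit Defensive.
Import GRing.Theory.
Local Open Scope ring_scope.

(** * Divisibility in commutative rings *)

Lemma rdvd_mull (R : comPzRingType) (a b c : R) : rdvd a b -> rdvd a (c * b).
Proof. by case=> d ->; exists (c * d); rewrite mulrA. Qed.

Lemma rdvd_mulr (R : comPzRingType) (a b c : R) : rdvd a b -> rdvd a (b * c).
Proof. by rewrite mulrC; apply: rdvd_mull. Qed.

Lemma rdvdD (R : comPzRingType) (a b c : R) :
  rdvd a b -> rdvd a c -> rdvd a (b + c).
Proof. by case=> x -> [y ->]; exists (x + y); rewrite mulrDl. Qed.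

Lemma rdvdN (R : comPzRingType) (a b : R) : rdvd a b -> rdvd a (- b).
Proof. by case=> x ->; exists (- x); rewrite mulNr. Qed.

Lemma rdvdB (R : comPzRingType) (a b c : R) :
  rdvd a b -> rdvd a c -> rdvd a (b - c).
Proof. by move=> ab ac; apply/rdvdD/rdvdN. Qed.

Lemma rdvd0 (R : comPzRingType) (a : R) : rdvd a 0.
Proof. by exists 0; rewrite mul0r. Qed.

Lemma rdvdxx (R : comPzRingType) (a : R) : rdvd a a.
Proof. by exists 1; rewrite mul1r. Qed.

Lemma rdvd_trans (R : comPzRingType) (a b c : R) :
  rdvd a b -> rdvd b c -> rdvd a c.
Proof. by move=> ab [x ->]; apply: rdvd_mull. Qed.

Lemma rdvd_sum (R : comPzRingType) (I : Type) (r : seq I) (P : pred I)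
    (F : I -> R) (a : R) :
  (forall i, P i -> rdvd a (F i)) -> rdvd a (\sum_(i <- r | P i) F i).
Proof.
move=> dF; elim/big_ind: _ => //; [exact: rdvd0 | exact: rdvdD].
Qed.

Lemma rdvd_unit (R : comUnitRingType) (a b : R) :
  rdvd a b -> b \is a GRing.unit -> a \is a GRing.unit.
Proof. by case=> c ->; rewrite unitrM => /andP[]. Qed.

Lemma unit_rdvd (R : comUnitRingType) (a b : R) :
  a \is a GRing.unit -> rdvd a b.
Proof. by move=> ua; exists (b / a); rewrite divrK. Qed.

(** * Prime elements, factorial domains and their gcds *)

Definition prime_elt (R : comUnitRingType) (p : R) : Prop :=
  [/\ p != 0, p \isn't a GRing.unit &
      forall a b : R, rdvd p (a * b) -> rdvd p a \/ rdvd p b].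

Definition prime_product (R : comUnitRingType) (a : R) : Prop :=
  exists u s, [/\ u \is a GRing.unit, forall p, p \in s -> prime_elt p
                & a = u * \prod_(p <- s) p].

Definition factorial_ring (R : idomainType) : Prop :=
  forall a : R, a != 0 -> prime_product a.

Section FactorialRing.

Variable R : idomainType.
Implicit Types a b c p q : R.

Lemma prime_rdvdX p a n : prime_elt p -> rdvd p (a ^+ n) -> rdvd p a.
Proof.
case=> p0 up pP; elim: n => [|n IHn].
  by move/rdvd_unit => /(_ (unitr1 _)); rewrite (negPf up).
by rewrite exprS => /pP[].
Qed.

Lemma prime_irreducible p : prime_elt p -> irreducible_elt p.
Proof.
case=> p0 up pP; split=> //; split=> // b c pE.
have b0 : b != 0 by apply: contraNneq p0 => b0; rewrite pE b0 mul0r.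
have c0 : c != 0 by apply: contraNneq p0 => c0; rewrite pE c0 mulr0.
have /pP[] : rdvd p (b * c) by rewrite -pE; apply: rdvdxx.
  case=> d bE; right; apply/unitrPr; exists d; apply: (mulfI b0).
  by rewrite mulrA -pE mulrC -bE mulr1.
case=> d cE; left; apply/unitrPr; exists d; apply: (mulfI c0).
by rewrite mulrA [c * b]mulrC -pE mulrC -cE mulr1.
Qed.

Lemma irreducible_rdvd_sym p q :
  irreducible_elt q -> p \isn't a GRing.unit -> rdvd p q -> rdvd q p.
Proof.
case=> q0 [uq qP] up [c qE]; case: (qP _ _ qE) => [uc|]; last by rewrite (negPf up).
by exists c^-1; rewrite qE mulKr.
Qed.

Lemma prime_productM a b :
  prime_product a -> prime_product b -> prime_product (a * b).
Proof.
move=> [u [s [uu sP ->]]] [v [t [uv tP ->]]]; exists (u * v), (s ++ t).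
split; first by rewrite unitrM uu.
  by move=> p; rewrite mem_cat => /orP[/sP|/tP].
by rewrite big_cat /=; ring.
Qed.

Hypothesis facR : factorial_ring R.

Lemma prime_factor a : a != 0 -> a \isn't a GRing.unit ->
  exists2 p, prime_elt p & rdvd p a.
Proof.
move=> a0 ua; have [u [[|p s] [uu sP aE]]] := facR a0.
  by move: ua; rewrite aE big_nil mulr1 uu.
exists p; first by apply: sP; rewrite mem_head.
by rewrite aE big_cons mulrCA; apply/rdvd_mulr/rdvdxx.
Qed.

Lemma irreducible_prime p : irreducible_elt p -> prime_elt p.
Proof.
move=> irrp; have [p0 [up _]] := irrp; have [q qP qp] := prime_factor p0 up.
have [q0 uq qM] := qP.
have pq := irreducible_rdvd_sym irrp uq qp.
split=> // a b pab; case: (qM a b (rdvd_trans qp pab)) => h; [left|right];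
  exact: rdvd_trans pq h.
Qed.

Lemma factorial_ind (P : R -> Prop) :
  (forall u, u \is a GRing.unit -> P u) ->
  (forall p a, prime_elt p -> a != 0 -> P a -> P (p * a)) ->
  forall a, a != 0 -> P a.
Proof.
move=> Pu Pp a a0; have [u [s [uu sP aE]]] := facR a0.
elim: s a a0 sP aE => [|p s IHs] a a0 sP aE; first by rewrite aE big_nil mulr1; apply: Pu.
have ps : prime_elt p by apply: sP; rewrite mem_head.
have bE : a = p * (u * \prod_(p <- s) p) by rewrite aE big_cons mulrCA.
have b0 : u * \prod_(p <- s) p != 0.
  by move: a0; rewrite bE mulf_eq0 negb_or => /andP[].
rewrite bE; apply: Pp => //; apply: IHs => // q qs; apply: sP.
by rewrite inE qs orbT.
Qed.

(** Induction on the prime factors of [a]. A prime that also divides [b] is split off from both and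
    multiplied back into the gcd; a prime not dividing [b] is dropped from [a]. *)
Lemma factorial_gcd a b : exists d, is_gcd_of (fun x => x = a \/ x = b) d.
Proof.
have [->|a0] := eqVneq a 0.
  exists b; split=> [x [->|->]|e eP]; [exact: rdvd0|exact: rdvdxx|by apply: eP; right].
elim/factorial_ind: a / a0 b => [u uu|p a pP a0 IHa] b.
  by exists u; split=> [x _|e eP]; [apply: unit_rdvd|apply: eP; left].
have [p0 up pM] := pP; have [[b' bE]|npb] := pselect (rdvd p b).
  have [d [dP dU]] := IHa b'; exists (p * d); split=> [x [->|->]|e eP].
  - by have [|c ->] := dP a; [left|exists c; rewrite mulrCA].
  - by rewrite bE; have [|c ->] := dP b'; [right|exists c; rewrite mulrAC -mulrA mulrCA mulrA].
  have [|c cE] := eP (p * a); first by left.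
  have [|c' c'E] := eP b; first by right.
  (* If [p] divides [e], it cancels from both equations; otherwise it divides the cofactors [c] and
     [c'], so [e] already divides [a] and [b']. *)
  have [x xE] : rdvd e (p * d).
    have [[e' eE]|npe] := pselect (rdvd p e).
      have [y ->] : rdvd e' d.
        apply: dU => x [->|->].
          by exists c; apply: (mulfI p0); rewrite cE eE; ring.
        by exists c'; apply: (mulIf p0); rewrite -bE c'E eE; ring.
      by exists y; rewrite eE; ring.
    have /rdvd_mull : rdvd e d; last exact.
    apply: dU => x [->|->].
      have /pM[[y yE]|//] : rdvd p (c * e) by rewrite -cE; apply/rdvd_mulr/rdvdxx.
      by exists y; apply: (mulfI p0); rewrite cE yE; ring.
    have /pM[[y yE]|//] : rdvd p (c' * e) by rewrite -c'E bE; apply/rdvd_mull/rdvdxx.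
    by exists y; apply: (mulIf p0); rewrite -bE c'E yE; ring.
  by exists x.
have [d [dP dU]] := IHa b; exists d; split=> [x [->|->]|e eP].
- by apply/rdvd_mull/dP; left.
- by apply: dP; right.
apply: dU => x [->|->]; last by apply: eP; right.
have [|c cE] := eP (p * a); first by left.
have /pM[[y yE]|pe] : rdvd p (c * e) by rewrite -cE; apply/rdvd_mulr/rdvdxx.
  by exists y; apply: (mulfI p0); rewrite cE yE; ring.
by case: npb; apply: rdvd_trans pe _; apply: eP; right.
Qed.

Lemma factorial_gcd_seq (s : seq R) : exists d, is_gcd_of (fun x => x \in s) d.
Proof.
elim: s => [|a s [d [dP dU]]].
  by exists 0; split=> // e _; apply: rdvd0.
have [d' [dP' dU']] := factorial_gcd a d.
exists d'; split=> [x|e eP].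
  rewrite inE => /predU1P[->|xs]; first by apply: dP'; left.
  by apply: rdvd_trans (dP _ xs); apply: dP'; right.
apply: dU' => x [->|->]; first by apply: eP; rewrite mem_head.
by apply: dU => y ys; apply: eP; rewrite inE ys orbT.
Qed.

End FactorialRing.

(** * Gauss's theorem: polynomials over a factorial domain *)

Lemma field_factorial (k : fieldType) : factorial_ring k.
Proof.
move=> a a0; exists a, [::]; split=> //; last by rewrite big_nil mulr1.
by rewrite unitfE.
Qed.

Section FactorialPoly.

Variable R : idomainType.
Implicit Types (p c : R) (a b f h : {poly R}).

Lemma polyC_unitE c : (c%:P \is a GRing.unit) = (c \is a GRing.unit).
Proof.
by rewrite poly_unitE coefC /= size_polyC; case: (eqVneq c 0) => /= [->|]; rewrite ?unitr0.
Qed.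

Lemma rdvd_polyC p a : (forall i, rdvd p a`_i) <-> rdvd p%:P a.
Proof.
split=> [pa|[b ->] i]; last by rewrite coefMC; apply/rdvd_mull/rdvdxx.
have /choice[q qE] : forall i, exists q, a`_i = q * p by [].
exists (\poly_(i < size a) q i); apply/polyP=> i; rewrite coefMC coef_poly.
by case: ltnP => [_|ai]; [apply: qE|rewrite mul0r nth_default].
Qed.

(** [p] divides the product of the leading coefficients, hence one of them; deleting that leading
    term keeps the divisibility and lowers the total size. *)
Lemma prime_polyC p : prime_elt p -> prime_elt p%:P.
Proof.
case=> p0 up pM; split; rewrite ?polyC_eq0 ?polyC_unitE // => a b.
have [n] := ubnP (size a + size b); elim: n a b => // n IHn a b; rewrite ltnS => sn pab.
have [->|a0] := eqVneq a 0; first by left; apply: rdvd0.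
have [->|b0] := eqVneq b 0; first by right; apply: rdvd0.
have small (q : {poly R}) : q != 0 -> (size (q - lead_coef q *: 'X^((size q).-1))%R < size q)%N.
  move=> q0; rewrite -[ltnRHS]prednK ?size_poly_gt0 // ltnS; apply/leq_sizeP=> j.
  rewrite leq_eqVlt coefB coefZ coefXn => /predU1P[<-|lj].
    by rewrite eqxx mulr1 subrr.
  rewrite gtn_eqF // mulr0 subr0 nth_default //.
  by rewrite -(prednK (_ : 0 < size q)%N) ?size_poly_gt0.
have lead (q : {poly R}) : rdvd p (lead_coef q) -> rdvd p%:P (lead_coef q *: 'X^((size q).-1)).
  by case=> x ->; rewrite -scalerA -!mul_polyC; apply/rdvd_mull/rdvd_mulr/rdvdxx.
have /pM[pl|pl] : rdvd p (lead_coef a * lead_coef b).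
    by rewrite -lead_coefM; apply: (rdvd_polyC _ _).2 pab _.
  have /IHn[| |] : (size (a - lead_coef a *: 'X^((size a).-1))%R + size b < n)%N.
  - by apply: leq_trans sn; rewrite ltn_add2r small.
  - by rewrite mulrBl; apply: rdvdB => //; apply/rdvd_mulr/lead.
  - by move=> pa; left; rewrite -(subrK (lead_coef a *: 'X^((size a).-1)) a); apply/rdvdD/lead.
  - by right.
have /IHn[| |] : (size a + size (b - lead_coef b *: 'X^((size b).-1))%R < n)%N.
- by apply: leq_trans sn; rewrite ltn_add2l small.
- by rewrite mulrBr; apply: rdvdB => //; apply/rdvd_mull/lead.
- by left.
- by move=> pa; right; rewrite -(subrK (lead_coef b *: 'X^((size b).-1)) b); apply/rdvdD/lead.
Qed.

Hypothesis facR : factorial_ring R.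

Definition primitive_poly f := forall p, prime_elt p -> ~ rdvd p%:P f.

(** The primes of [c] are removed one by one: each divides the product of [f] and its cofactor,
    hence the cofactor, as [f] is primitive. *)
Lemma primitive_rdvd_cancel f a c :
  primitive_poly f -> c != 0 -> rdvd f (c%:P * a) -> rdvd f a.
Proof.
move=> primf c0; elim/(factorial_ind facR): c / c0 a => [u uu|p c pP c0 IHc] a.
  by case=> h hE; exists (u^-1%:P * h); rewrite -mulrA -hE mulrA -polyCM mulVr // mul1r.
rewrite polyCM -mulrA => -[h hE]; apply: IHc.
have [pp0 _ ppM] := prime_polyC pP.
have /ppM[[h' h'E]|/primf//] : rdvd p%:P (h * f) by rewrite -hE; apply/rdvd_mulr/rdvdxx.
by exists h'; apply: (mulfI pp0); rewrite hE h'E; ring.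
Qed.

(** Factorizations over the fraction field descend: each prime of [c] divides [a] or [b] and is
    cancelled there, which leaves the sizes unchanged. *)
Lemma clear_denominator f a b c : c != 0 -> c%:P * f = a * b ->
  exists a' b', [/\ f = a' * b', size a' = size a & size b' = size b].
Proof.
move=> c0; elim/(factorial_ind facR): c / c0 a b => [u uu|p c pP c0 IHc] a b.
  move=> fE; exists (u^-1 *: a), b; split=> //.
    by rewrite -scalerAl -fE -mul_polyC mulrA -polyCM mulVr ?mul1r.
  by rewrite size_scale // invr_eq0; apply: contraTneq uu => ->; rewrite unitr0.
rewrite polyCM -mulrA => fE; have [p0 _ _] := pP.
have [pp0 _ ppM] := prime_polyC pP.
have /ppM[[a' aE]|[b' bE]] : rdvd p%:P (a * b) by rewrite -fE; apply/rdvd_mulr/rdvdxx.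
  have [|a1 [b1 [-> sa1 sb1]]] := IHc a' b.
    by apply: (mulfI pp0); rewrite fE aE; ring.
  by exists a1, b1; split=> //; rewrite aE mulrC mul_polyC size_scale.
have [|a1 [b1 [-> sa1 sb1]]] := IHc a b'.
  by apply: (mulfI pp0); rewrite fE bE; ring.
by exists a1, b1; split=> //; rewrite bE mulrC mul_polyC size_scale.
Qed.

Lemma primitive_const_unit c : primitive_poly c%:P -> c != 0 -> c \is a GRing.unit.
Proof.
move=> primc c0; apply/negPn/negP=> uc; have [p pP pc] := prime_factor facR c0 uc.
by apply: (primc p pP); apply/rdvd_polyC => i; rewrite coefC; case: ifP => // _; apply: rdvd0.
Qed.

Lemma irreducible_primitive f : irreducible_elt f -> (1 < size f)%N -> primitive_poly f.
Proof.
case=> f0 [uf fP] sf p [p0 up _] [h fE].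
have [uh|] := fP _ _ fE; last by rewrite polyC_unitE (negPf up).
move: uh; rewrite poly_unitE => /andP[/size_poly1P[c c0 hE] _].
by move: sf; rewrite fE hE -polyCM size_polyC; case: eqP.
Qed.

(** The gcd of [f] and [a] over the fraction field divides [f] up to a constant. Clearing
    denominators gives a genuine factorization of [f], so either the gcd is constant or it is [f] up
    to constants; in the latter case primitivity gives true divisibility. *)
Lemma irreducible_dvdp f a : irreducible_elt f -> (1 < size f)%N ->
  rdvd f a \/ coprimep f a.
Proof.
move=> irrf sf; have [f0 [uf fP]] := irrf; have primf := irreducible_primitive irrf sf.
have /Pdiv.Idomain.dvdpP[[c e] /= c0 cE] := dvdp_gcdl f a.
rewrite -mul_polyC in cE; have [a' [b' [fE sa sb]]] := clear_denominator c0 cE.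
have [ua|ub] := fP _ _ fE; last first.
  right; rewrite coprimep_def -sb.
  by move: ub; rewrite poly_unitE => /andP[].
left; have /eqP se : size e == 1 by rewrite -sa; move: ua; rewrite poly_unitE => /andP[].
have /Pdiv.Idomain.dvdpP[[c' e'] /= c'0 c'E] := dvdp_gcdr f a.
have /eqP/size_poly1P[d d0 eE] := se.
apply: (@primitive_rdvd_cancel f a (d * c')) => //; first by rewrite mulf_neq0.
exists (e' * c%:P); rewrite polyCM -mulrA mul_polyC (mul_polyC c') c'E -mulrA cE eE -mul_polyC.
by ring.
Qed.

(** If [f] does not divide [a], a Bezout identity multiplied by [b] shows that [f] divides a
    constant multiple of [b], and primitivity removes the constant. *)
Lemma irreducible_poly_prime f : irreducible_elt f -> (1 < size f)%N -> prime_elt f.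
Proof.
move=> irrf sf; have [f0 [uf fP]] := irrf; split=> // a b fab.
have [?|cop] := irreducible_dvdp a irrf sf; [by left|right].
have /Bezout_coprimepP[[u v] /= /eqpP[[c d] /= /andP[c0 d0] uvE]] := cop.
apply: (@primitive_rdvd_cancel f b d) => //; first exact: irreducible_primitive.
have -> : d%:P * b = c%:P * (u * b) * f + c%:P * v * (a * b).
  rewrite -alg_polyC -uvE -mul_polyC; ring.
by apply: rdvdD; apply: rdvd_mull => //; apply: rdvdxx.
Qed.

(** A prime dividing [f] divides its leading coefficient, so the extraction of constant primes runs
    through the prime factors of that coefficient. *)
Lemma poly_content f : f != 0 ->
  exists c f0, [/\ c != 0, f = c%:P * f0 & primitive_poly f0].
Proof.
move=> f0; have lf : lead_coef f != 0 by rewrite lead_coef_eq0.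
(* The cofactor [e] collects the primes of the leading coefficient already
   known not to divide [f]. *)
suff gen l : l != 0 -> forall e f, f != 0 -> rdvd (lead_coef f) (l * e) ->
    (forall q, prime_elt q -> rdvd q%:P f -> ~ rdvd q e) ->
    exists c f0, [/\ c != 0, f = c%:P * f0 & primitive_poly f0].
  apply: (gen _ lf 1 f f0) => [|q [_ uq _] _ /rdvd_unit/(_ (unitr1 _))].
    by rewrite mulr1; apply: rdvdxx.
  by rewrite (negPf uq).
move=> l0; elim/(factorial_ind facR): l / l0 => [u uu|p l pP l0 IHl] e {lf f0}f f0 lE eP.
  exists 1, f; split; rewrite ?oner_neq0 ?mul1r // => q qP qf.
  have [q0 uq qM] := qP; have ql : rdvd q (lead_coef f) by apply: (rdvd_polyC _ _).2 qf _.
  case: (qM _ _ (rdvd_trans ql lE)); last exact: eP.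
  by move/rdvd_unit/(_ uu); rewrite (negPf uq).
have [p0 up pM] := pP; have [[h fE]|npf] := pselect (rdvd p%:P f).
  have h0 : h != 0 by apply: contraNneq f0 => h0; rewrite fE h0 mul0r.
  have [||c [f1 [c0 hE primf1]]] := IHl e h h0.
  - case: lE => x; rewrite fE lead_coefM lead_coefC => xE; exists x.
    by apply: (mulfI p0); rewrite !mulrA xE; ring.
  - by move=> q qP qh; apply: eP => //; rewrite fE; apply: rdvd_mulr.
  exists (p * c), f1; split=> //; first by rewrite mulf_neq0.
  by rewrite fE hE polyCM; ring.
apply: (IHl (p * e) f f0); first by rewrite mulrA [l * p]mulrC.
move=> q qP qf; have [_ uq qM] := qP; case/qM; last exact: eP.
move/(irreducible_rdvd_sym (prime_irreducible pP) uq) => -[x qE].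
by apply: npf; apply: rdvd_trans qf; exists x%:P; rewrite -polyCM -qE.
Qed.

(** The content is factored in [R]. In a splitting of the primitive part into nonunits both factors
    have positive degree, because constant factors are units, so induction on the size applies. *)
Lemma poly_factorial : factorial_ring {poly R}.
Proof.
move=> f f0; have [n] := ubnP (size f); elim: n f f0 => // n IHn f f0; rewrite ltnS => sn.
have [c [h [c0 fE primh]]] := poly_content f0; rewrite fE.
have h0 : h != 0 by apply: contraNneq f0 => h0; rewrite fE h0 mulr0.
have sh : size h = size f by rewrite fE mul_polyC size_scale.
apply: prime_productM.
  have [u [s [uu sP cE]]] := facR c0; exists u%:P, (map polyC s).
  split; first by rewrite polyC_unitE.
    by move=> _ /mapP[p ps ->]; apply/prime_polyC/sP.
  by rewrite big_map cE polyCM rmorph_prod.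
have [sh1|sh1] := leqP (size h) 1.
  exists h, [::]; rewrite big_nil mulr1; split=> //.
  move: primh h0; rewrite (size1_polyC sh1) polyC_unitE polyC_eq0; exact: primitive_const_unit.
have uh : h \isn't a GRing.unit.
  by rewrite poly_unitE; apply: contraL sh1 => /andP[/eqP-> _].
have [irrh|nirrh] := pselect (irreducible_elt h).
  exists 1, [:: h]; rewrite unitr1 big_seq1 mul1r; split=> // p.
  by rewrite inE => /eqP->; apply: irreducible_poly_prime.
have [a [b [hE ua ub]]] : exists a b, [/\ h = a * b, a \isn't a GRing.unit & b \isn't a GRing.unit].
  apply: contrapT => nab; apply: nirrh; split=> //; split=> // a b hE.
  have [ua|ua] := boolP (a \is a GRing.unit); [by left|right].
  by apply/negPn/negP=> ub; apply: nab; exists a, b.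
have a0 : a != 0 by apply: contraNneq h0 => a0; rewrite hE a0 mul0r.
have b0 : b != 0 by apply: contraNneq h0 => b0; rewrite hE b0 mulr0.
have big_size (x y : {poly R}) : h = x * y -> x != 0 -> x \isn't a GRing.unit -> (1 < size x)%N.
  move=> xyE x0 ux; rewrite ltnNge; apply/negP=> sx; case/negP: ux.
  move: x0; rewrite (size1_polyC sx) polyC_unitE polyC_eq0; apply: primitive_const_unit.
  by move=> p pP px; apply: (primh p pP); rewrite xyE; apply: rdvd_mulr; rewrite (size1_polyC sx).
have sa : (1 < size a)%N by apply: big_size hE a0 ua.
have sb : (1 < size b)%N by apply: (big_size b a) => //; rewrite mulrC.
have sab : ((size a + size b).-1 <= n)%N by rewrite -size_mul // -hE sh.
rewrite hE; apply: prime_productM; apply: IHn => //.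
  by apply: leq_trans sab; case: (size b) sb => [//|[//|?]] _; rewrite !addnS /= ltnS leq_addr.
by apply: leq_trans sab; case: (size a) sa => [//|[//|?]] _; rewrite !addSn /= ltnS leq_addl.
Qed.

End FactorialPoly.

(** * Eisenstein's criterion and elimination of the last variable *)

Section IrreduciblePoly.

Variable R : idomainType.

(** Exactly one of the two constant terms is divisible by [l]. Only constancy of a factor is
    concluded, since a constant need not be a unit of [R]. *)
Lemma eisenstein (l : R) (f a b : {poly R}) :
  prime_elt l -> (1 < size f)%N -> f = a * b ->
  (forall i, (i < (size f).-1)%N -> rdvd l f`_i) ->
  ~ rdvd l (lead_coef f) -> ~ rdvd (l ^+ 2) f`_0 ->
  size a = 1 \/ size b = 1.
Proof.
move=> lP sf fE lf nlf nl2; have [l0 ul lM] := lP.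
have f0 : f != 0 by rewrite -size_poly_gt0 ltnW.
(* If [d] were not constant, all coefficients of [c] would sit in degrees below the top of [f];
   strong induction would then make [l] divide each of them, including the leading one. *)
have half (c d : {poly R}) : f = c * d -> rdvd l c`_0 -> ~ rdvd l d`_0 -> size d = 1.
  move=> cdE lc nld.
  have c0 : c != 0 by apply: contraNneq f0 => c0; rewrite cdE c0 mul0r.
  have d0 : d != 0 by apply: contraNneq f0 => d0; rewrite cdE d0 mulr0.
  apply/eqP; rewrite eqn_leq size_poly_gt0 d0 andbT leqNgt; apply/negP=> sd.
  case: nlf; rewrite cdE lead_coefM; apply: rdvd_mulr; rewrite lead_coefE.
  have sc : ((size c).-1 < (size f).-1)%N.
    rewrite cdE size_mul //; move: sd; case: (size d) => [//|[//|x]] _.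
    rewrite !addnS /= -[ltnLHS]addn0; move: (c0); rewrite -size_poly_gt0.
    by case: (size c) => //= y _; rewrite addn0 addSn ltnS leq_addr.
  move: (size c).-1 sc => i; have [j] := ubnP i; elim: j i => // j IHj i.
  rewrite ltnS => ij si; have := lf i si; rewrite cdE coefM big_ord_recr /= subnn => lS.
  have /lM[//|//] : rdvd l (c`_i * d`_0).
  rewrite -[X in rdvd _ X](addKr (\sum_(j0 < i) c`_j0 * d`_(i - j0))).
  apply: rdvdD lS; apply: rdvdN; apply: rdvd_sum => -[x xi] _ /=; apply: rdvd_mulr.
  by apply: IHj; [apply: leq_trans ij|apply: ltn_trans si].
have e0 : f`_0 = a`_0 * b`_0 by rewrite fE coef0M.
have /lM[la|lb] : rdvd l (a`_0 * b`_0).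
- by rewrite -e0; apply: lf; case: (size f) sf => [//|[]].
- right; apply: (half _ _ fE la) => -[y yE]; case: la => x xE.
  by apply: nl2; exists (x * y); rewrite e0 xE yE; ring.
left; apply: (half b a) => //; first by rewrite mulrC.
case=> x xE; case: lb => y yE.
by apply: nl2; exists (x * y); rewrite e0 xE yE; ring.
Qed.

Hypothesis facR : factorial_ring R.

Lemma irreducible_elimination (p q : {poly R}) : irreducible_elt p -> ~ rdvd p q ->
  exists r u v, r != 0 /\ r%:P = u * p + v * q.
Proof.
move=> irrp npq; have [sp|sp] := leqP (size p) 1.
  exists p`_0, 1, 0; rewrite -size1_polyC // mul1r mul0r addr0; split=> //.
  by have [p0 _] := irrp; move: p0; rewrite {1}(size1_polyC sp) polyC_eq0.
have [//|cop] := irreducible_dvdp facR q irrp sp.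
have /Bezout_coprimepP[[u v] /= /eqpP[[c d] /= /andP[c0 d0] uvE]] := cop.
exists d, (c%:P * u), (c%:P * v); split=> //.
by rewrite -alg_polyC -uvE -mul_polyC; ring.
Qed.

(** As [l] divides [1 - p ^+ 2], the sum reduces to [p ^+ 2 * 'X^N] modulo [l]. The exponent exceeds
    the degree of ['X^2 * q ^+ 2], so the leading coefficient is [p ^+ 2]; the factor ['X^2] keeps
    the constant term equal to [p ^+ 2 * l]. Thus Eisenstein's criterion applies at [l]. *)
Lemma eisenstein_combination_irreducible (p l : R) (q : {poly R}) :
  prime_elt p -> prime_elt l -> rdvd l (1 + p) -> ~ rdvd p%:P q ->
  irreducible_elt ((p ^+ 2)%:P * ('X^((size q).*2.+2) + l%:P)
                   + (1 - p ^+ 2)%:P * ('X^2 * q ^+ 2)).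
Proof.
move=> pP lP lp npq; have [p0 up pM] := pP; have [l0 ul lM] := lP.
have prime1 (x : R) : prime_elt x -> ~ rdvd x 1.
  by case=> _ ux _ /rdvd_unit/(_ (unitr1 _)); rewrite (negPf ux).
set N := (size q).*2.+2; set w := _ + _.
have sq : (size ('X^2 * q ^+ 2)%R <= N)%N.
  apply: leq_trans (size_polyMleq _ _) _; rewrite size_polyXn /= !addSn /= !ltnS.
  by apply: leq_trans (size_polyMleq _ _) _; rewrite addnn leq_pred.
have wE i : w`_i = p ^+ 2 * ((i == N)%:R + (i == 0%N)%:R * l) + (1 - p ^+ 2) * ('X^2 * q ^+ 2)`_i.
  rewrite /w coefD !coefCM coefD coefXn coefC.
  by case: (i == 0%N); rewrite ?mul1r ?mul0r.
have wN : w`_N = p ^+ 2.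
  by rewrite wE eqxx /= mul0r addr0 mulr1 nth_default // mulr0 addr0.
have p20 : p ^+ 2 != 0 by rewrite expf_neq0.
have sw : size w = N.+1.
  apply/eqP; rewrite eqn_leq; apply/andP; split.
    apply/leq_sizeP=> j Nj; rewrite wE gtn_eqF // gtn_eqF; last exact: leq_trans Nj.
    by rewrite mul0r addr0 mulr0 add0r nth_default ?mulr0 // (leq_trans sq) // ltnW.
  by rewrite ltnNge; apply: contra_neqN p20 => sw; rewrite -wN nth_default.
have lw : lead_coef w = p ^+ 2 by rewrite lead_coefE sw.
have w0 : w`_0 = p ^+ 2 * l by rewrite wE coefXnM /= mulr0 addr0 add0r mul1r.
have nlp : ~ rdvd l (p ^+ 2).
  move/(prime_rdvdX lP) => lpp; apply: (prime1 _ lP).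
  by rewrite -(addrK p 1); apply: rdvdB.
have wnz : w != 0 by rewrite -size_poly_gt0 sw.
split=> //; split; first by rewrite poly_unitE sw.
(* A prime of a constant factor divides the leading coefficient [p ^+ 2], so it is associated to
   [p]; then [p] divides [w], hence [(1 - p ^+ 2) * 'X^2 * q ^+ 2], hence one of these factors,
   which is impossible. *)
have const_unit (c d : {poly R}) : w = c * d -> size c = 1 -> c \is a GRing.unit.
  move=> cdE /eqP/size_poly1P[e e0 cE]; rewrite cE polyC_unitE; apply/negPn/negP=> ue.
  have [x xP xe] := prime_factor facR e0 ue; have [x0 ux xM] := xP.
  have xw i : rdvd x w`_i.
    by rewrite cdE cE coefCM; apply: rdvd_mulr.
  have xp : rdvd x p by apply: (prime_rdvdX xP (n := 2)); rewrite -wN.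
  have px := irreducible_rdvd_sym (prime_irreducible pP) ux xp.
  have pw : rdvd p%:P w by apply/rdvd_polyC => i; apply: rdvd_trans px _.
  have [pp0 upp ppM] := prime_polyC pP.
  have : rdvd p%:P ((1 - p ^+ 2)%:P * ('X^2 * q ^+ 2)).
    rewrite -[X in rdvd _ X](addKr ((p ^+ 2)%:P * ('X^N + l%:P))).
    apply: rdvdD pw; apply: rdvdN; rewrite expr2 polyCM -mulrA.
    by apply/rdvd_mulr/rdvdxx.
  case/ppM=> [|/ppM[]].
  - move/(rdvd_polyC _ _).2/(_ 0%N); rewrite coefC /= => pp; apply: (prime1 _ pP).
    rewrite -(subrK (p ^+ 2) 1); apply: rdvdD => //.
    by rewrite expr2; apply/rdvd_mulr/rdvdxx.
  - move/(rdvd_polyC _ _).2/(_ 2%N); rewrite coefXn /=; exact: prime1.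
  by move/(prime_rdvdX (prime_polyC pP)).
move=> b c wbc.
have sw1 : (1 < size w)%N by rewrite sw.
have [i iN|||s1|s1] := eisenstein lP sw1 wbc; rewrite ?lw ?w0 //.
- rewrite sw /= in iN; rewrite wE ltn_eqF // add0r; apply: rdvdD.
    by apply/rdvd_mull/rdvd_mull/rdvdxx.
  apply: rdvd_mulr; have -> : 1 - p ^+ 2 = (1 - p) * (1 + p) by ring.
  exact: rdvd_mull.
- case=> x xE; apply: nlp; exists x; apply: (mulIf l0); rewrite xE; ring.
- by left; apply: const_unit wbc s1.
by right; apply: (const_unit c b) => //; rewrite mulrC.
Qed.

End IrreduciblePoly.

Lemma mpoly_factorial (k : fieldType) n : factorial_ring (mpoly k n).
Proof. by elim: n => [|n IHn] /=; [apply: field_factorial|apply: poly_factorial]. Qed.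

(** * Evaluation, partial derivatives and the chain rule *)

Section MPolyMorphisms.

Variable R : idomainType.

Lemma mconst_morph n : zmod_morphism (@mconst R n) /\ monoid_morphism (@mconst R n).
Proof.
elim: n => [|n [IHB [IH1 IHM]]] //=; split; [|split] => [x y||x y] /=.
- by rewrite IHB polyCB.
- by rewrite IH1.
- by rewrite IHM polyCM.
Qed.

HB.instance Definition _ n :=
  GRing.isZmodMorphism.Build R (mpoly R n) (@mconst R n) (mconst_morph n).1.
HB.instance Definition _ n :=
  GRing.isMonoidMorphism.Build R (mpoly R n) (@mconst R n) (mconst_morph n).2.

Lemma meval_morph n m (fs : nat -> mpoly R n) :
  zmod_morphism (@meval R n m fs) /\ monoid_morphism (@meval R n m fs).
Proof.
elim: m => [|m [IHB IHM]] /=.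
  by split; [exact: rmorphB|split; [exact: rmorph1|exact: rmorphM]].
pose phi : {rmorphism mpoly R m -> mpoly R n} :=
  HB.pack (@meval R n m fs) (GRing.isZmodMorphism.Build _ _ _ IHB)
    (GRing.isMonoidMorphism.Build _ _ _ IHM).
rewrite -[meval fs]/(phi : _ -> _); split; [|split] => [x y||x y].
- by rewrite rmorphB /= hornerD hornerN.
- by rewrite rmorph1 hornerC.
- by rewrite rmorphM /= hornerM.
Qed.

HB.instance Definition _ n m fs :=
  GRing.isZmodMorphism.Build (mpoly R m) (mpoly R n) (@meval R n m fs) (meval_morph m fs).1.
HB.instance Definition _ n m fs :=
  GRing.isMonoidMorphism.Build (mpoly R m) (mpoly R n) (@meval R n m fs) (meval_morph m fs).2.

Lemma mderiv_is_zmod_morphism n i : zmod_morphism (@mderiv R n i).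
Proof.
elim: n => [|n IHn] x y /=; first by rewrite subr0.
case: eqP => _; first by rewrite derivB.
pose phi : {additive mpoly R n -> mpoly R n} :=
  HB.pack (@mderiv R n i) (GRing.isZmodMorphism.Build _ _ _ IHn).
by rewrite -[mderiv i]/(phi : _ -> _) raddfB.
Qed.

HB.instance Definition _ n i :=
  GRing.isZmodMorphism.Build (mpoly R n) (mpoly R n) (@mderiv R n i) (@mderiv_is_zmod_morphism n i).

Lemma mderivD n i (a b : mpoly R n) : mderiv i (a + b) = mderiv i a + mderiv i b.
Proof. exact: raddfD. Qed.

Lemma mderivM n i (a b : mpoly R n) :
  mderiv i (a * b) = mderiv i a * b + a * mderiv i b.
Proof.
elim: n a b => [|n IHn] a b /=; first by rewrite mul0r mulr0 addr0.
case: eqP => _; first by rewrite derivM.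
apply/polyP=> j; rewrite coefD coef_map /= !coefM raddf_sum -big_split /=.
by apply: eq_bigr => l _; rewrite IHn !coef_map.
Qed.

Lemma mderiv_const n i c : mderiv i (mconst n c : mpoly R n) = 0.
Proof.
elim: n => [|n IHn] //=; case: eqP => _; first by rewrite derivC.
by rewrite map_polyC /= IHn.
Qed.

Lemma mderiv_natr n i j : mderiv i (j%:R : mpoly R n) = 0.
Proof. by rewrite -(rmorph_nat (@mconst R n)) mderiv_const. Qed.

Lemma mderiv_last n (w : {poly mpoly R n}) : mderiv n (w : mpoly R n.+1) = w^`().
Proof. by rewrite /= eqxx. Qed.

Lemma mderiv_coef n i (w : {poly mpoly R n}) : (i < n)%N ->
  mderiv i (w : mpoly R n.+1) = map_poly (mderiv i) w.
Proof. by move=> lin; rewrite /= ltn_eqF. Qed.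

Lemma mderiv_mX n i j : (i < n)%N -> (j < n)%N ->
  mderiv i (mX R n j) = (i == j)%:R.
Proof.
elim: n => //= n IHn; rewrite !ltnS => lin ljn.
case: (eqVneq j n) => [->|jn].
  case: (eqVneq i n) => _; first by rewrite derivX.
  by apply/polyP=> x; rewrite coef_map coefX coef0 /= mderiv_natr.
have {}ljn : (j < n)%N by rewrite ltn_neqAle jn.
case: (eqVneq i n) => [->|ni]; first by rewrite derivC gtn_eqF.
have {}lin : (i < n)%N by rewrite ltn_neqAle ni.
by rewrite map_polyC /= IHn // rmorph_nat.
Qed.

Lemma meval_wide n m N (fs : nat -> mpoly R n) (w : {poly mpoly R m}) :
  (size w <= N)%N -> meval fs (w : mpoly R m.+1) = \sum_(i < N) meval fs w`_i * fs m ^+ i.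
Proof.
move=> sw; rewrite /= (horner_coef_wide (n := N)).
  by apply: eq_bigr => i _; rewrite coef_map.
by apply: leq_trans sw; apply: size_poly.
Qed.

Lemma meval_polyC n m (fs : nat -> mpoly R n) (c : mpoly R m) :
  meval fs (c%:P : mpoly R m.+1) = meval fs c.
Proof. by rewrite /= map_polyC hornerC. Qed.

Lemma meval_polyX n m (fs : nat -> mpoly R n) :
  meval fs ('X : mpoly R m.+1) = fs m.
Proof. by rewrite /= map_polyX hornerX. Qed.

Lemma meval_const n m (fs : nat -> mpoly R n) c :
  meval fs (mconst m c) = mconst n c.
Proof. by elim: m => // m IHm; rewrite -IHm; apply: meval_polyC. Qed.

Lemma eq_meval n m (fs gs : nat -> mpoly R n) :
  (forall i, (i < m)%N -> fs i = gs i) -> @meval R n m fs =1 meval gs.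
Proof.
elim: m => [|m IHm] fg w //=; rewrite fg // (eq_map_poly (IHm _)) // => i im.
by apply: fg; apply: ltnW.
Qed.

Lemma meval_MXaddC n m (fs : nat -> mpoly R n) (v : {poly mpoly R m}) (c : mpoly R m) :
  meval fs (v * 'X + c%:P : mpoly R m.+1) = meval (m := m.+1) fs v * fs m + meval fs c.
Proof.
by rewrite -(meval_polyC fs c) -(meval_polyX m fs) -[in RHS]rmorphM -rmorphD.
Qed.

(** Chain rule, by induction on the number of variables and, in the last variable, on the Horner
    form [v * 'X + c]. *)
Lemma mderiv_meval n m (fs : nat -> mpoly R n) i (w : mpoly R m) :
  mderiv i (meval fs w) = \sum_(a < m) meval fs (mderiv a w) * mderiv i (fs a).
Proof.
elim: m w => [|m IHm] w; first by rewrite big_ord0 /= mderiv_const.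
elim/poly_ind: (w : {poly mpoly R m}) => {w} [|v c IHv].
  by rewrite !raddf0 big1 // => a _; rewrite raddf0 rmorph0 mul0r.
have lowE (a : 'I_m) : meval fs (mderiv a (v * 'X + c%:P : mpoly R m.+1)) =
    meval fs (mderiv a (v : mpoly R m.+1)) * fs m + meval fs (mderiv a c).
  rewrite !mderiv_coef // -meval_MXaddC; congr meval; apply/polyP=> j.
  rewrite coef_map !coefD !coefMX !coefC coef_map /= mderivD.
  by case: j => [|j]; rewrite ?raddf0.
have lastE : meval fs (mderiv m (v * 'X + c%:P : mpoly R m.+1)) =
    meval fs (mderiv m (v : mpoly R m.+1)) * fs m + meval (m := m.+1) fs v.
  rewrite !mderiv_last derivD derivM derivX derivC addr0 mulr1 rmorphD.
  by congr (_ + _); rewrite -(meval_polyX m fs) -rmorphM.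
rewrite meval_MXaddC mderivD mderivM IHm IHv !big_ord_recr mulrDl -!addrA /=.
transitivity (\sum_(a < m) (meval fs (mderiv a (v : mpoly R m.+1)) * fs m
   + meval fs (mderiv a c)) * mderiv i (fs a)
   + (meval fs (mderiv m (v : mpoly R m.+1)) * fs m + meval (m := m.+1) fs v) * mderiv i (fs m)).
  under [in RHS]eq_bigr => a _ do rewrite mulrDl mulrAC.
  rewrite big_split -mulr_suml /=; ring.
congr (_ + _); last by rewrite -lastE.
by apply: eq_bigr => a _; rewrite -lowE.
Qed.

End MPolyMorphisms.

(** * Polynomials of bounded degree in each variable *)

Section BoxDegree.

Variable R : idomainType.

(** Bounding each variable separately, rather than the total degree, turns polynomials into arrays
    of [d.+1 ^ n] coefficients. *)
Fixpoint mdeg_le (n d : nat) : mpoly R n -> Prop :=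
  if n is n'.+1 return mpoly R n -> Prop then
    fun p : {poly mpoly R n'} => (size p <= d.+1)%N /\ forall i, mdeg_le d p`_i
  else fun _ => True.

Lemma mdeg_le0 n d : mdeg_le d (0 : mpoly R n).
Proof.
by elim: n => //= n IHn; rewrite size_poly0; split=> // i; rewrite coef0.
Qed.

Lemma mdeg_leD n d (a b : mpoly R n) : mdeg_le d a -> mdeg_le d b -> mdeg_le d (a + b).
Proof.
elim: n a b => //= n IHn a b [sa da] [sb db]; split=> [|i]; last by rewrite coefD; apply: IHn.
by rewrite (leq_trans (size_polyD _ _)) // geq_max sa.
Qed.

Lemma mdeg_le_sum n d (I : Type) (r : seq I) (P : pred I) (F : I -> mpoly R n) :
  (forall i, P i -> mdeg_le d (F i)) -> mdeg_le d (\sum_(i <- r | P i) F i).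
Proof. by move=> dF; elim/big_ind: _ => //; [apply: mdeg_le0|apply: mdeg_leD]. Qed.

Lemma mdeg_leW n d e (a : mpoly R n) : (d <= e)%N -> mdeg_le d a -> mdeg_le e a.
Proof.
move=> de; elim: n a => //= n IHn a [sa da]; split=> [|i]; last exact: IHn.
exact: leq_trans sa _.
Qed.

Lemma mdeg_leM n d e (a b : mpoly R n) :
  mdeg_le d a -> mdeg_le e b -> mdeg_le (d + e) (a * b).
Proof.
elim: n a b => //= n IHn a b [sa da] [sb db]; split=> [|i].
  rewrite (leq_trans (size_polyMleq _ _)) // -subn1 leq_subLR.
  by apply: leq_trans (leq_add sa sb) _; rewrite addSn addnS.
by rewrite coefM; apply: mdeg_le_sum => j _; apply: IHn.
Qed.

Lemma mdeg_le_const n d c : mdeg_le d (mconst n c : mpoly R n).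
Proof.
elim: n => //= n IHn; split=> [|i]; first by rewrite size_polyC; case: (_ != 0).
by rewrite coefC; case: ifP => // _; apply: mdeg_le0.
Qed.

Lemma mdeg_leX n d (a : mpoly R n) i : mdeg_le d a -> mdeg_le (i * d) (a ^+ i).
Proof.
move=> da; elim: i => [|i IHi]; last by rewrite exprS mulSn; apply: mdeg_leM.
by rewrite expr0 -(rmorph1 (@mconst R n)); apply: mdeg_le_const.
Qed.

Lemma mdeg_le_ex n (a : mpoly R n) : exists d, mdeg_le d a.
Proof.
elim: n a => [|n IHn] a; first by exists 0%N.
have /choice[d dP] : forall i, exists d, mdeg_le d (a : {poly mpoly R n})`_i by [].
exists (size (a : {poly _}) + \max_(i < size (a : {poly mpoly R n})) d i)%N; split=> [|i].
  by rewrite -addSn; apply: leq_trans (leq_addr _ _).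
have [ia|ia] := ltnP i (size (a : {poly mpoly R n})); last first.
  by rewrite nth_default //; apply: mdeg_le0.
apply: mdeg_leW (dP i); apply: leq_trans (leq_addl _ _).
exact: (leq_bigmax (Ordinal ia)).
Qed.

Lemma mdeg_le_meval n m d e (fs : nat -> mpoly R n) (w : mpoly R m) :
  (forall i, (i < m)%N -> mdeg_le e (fs i)) -> mdeg_le d w -> mdeg_le (m * (d * e)) (meval fs w).
Proof.
elim: m w => [|m IHm] w dfs dw; first exact: mdeg_le_const.
case: dw => sw dw; rewrite (meval_wide _ (leqnn _)); apply: mdeg_le_sum => -[i iw] _ /=.
apply: (@mdeg_leW _ (m * (d * e) + i * e)).
  by rewrite mulSn addnC leq_add2r leq_mul2r -ltnS (leq_trans iw) ?orbT.
apply: mdeg_leM; last by apply/mdeg_leX/dfs.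
by apply: IHm (dw i) => j jm; apply: dfs; apply: ltnW.
Qed.

End BoxDegree.

(** * Algebraic dependence by counting dimensions *)

Lemma linear_kernel (k : fieldType) a b (T : 'rV[k]_a -> 'rV[k]_b) :
  linear T -> (b < a)%N -> exists2 v, v != 0 & T v = 0.
Proof.
move=> linT ba; pose f : {linear 'rV[k]_a -> 'rV[k]_b} :=
  HB.pack T (GRing.isLinear.Build _ _ _ _ _ linT).
have : kermx (lin1_mx f) != 0.
  rewrite kermx_eq0 /row_free ltn_eqF //.
  exact: leq_ltn_trans (rank_leq_col _) ba.
case/rowV0Pn=> v /sub_kermxP; rewrite mul_rV_lin1 => vE v0; by exists v.
Qed.

Section AlgebraicDependence.

Variable k : fieldType.

Lemma mdeg_le_decode m d : exists dec : 'rV[k]_(d.+1 ^ m) -> mpoly k m,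
  [/\ forall c u v, dec (c *: u + v) = mconst m c * dec u + dec v,
      forall v, dec v = 0 -> v = 0 & forall v, mdeg_le d (dec v)].
Proof.
elim: m => [|m [dec [decD dec0 decd]]].
  exists (fun v => v 0 0); split=> //= [c u v|v v0]; first by rewrite !mxE.
  by apply/rowP=> i; rewrite mxE ord1 v0.
rewrite expnS; exists (fun v => \poly_(i < d.+1) dec (row (inord i) (vec_mx v))).
split=> [c u v|v /polyP v0|v] /=.
- apply/polyP=> i; rewrite coefD coefCM !coef_poly.
  by case: ltnP => _; rewrite ?mulr0 ?addr0 // linearP linearP decD.
- apply: (can_inj vec_mxK); rewrite linear0; apply/row_matrixP=> i.
  have := v0 i; rewrite coef_poly coef0 ltn_ord inord_val => /dec0 ->.
  by rewrite row0.
split=> [|i]; first exact: size_poly.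
by rewrite coef_poly; case: ifP => _ //; apply: mdeg_le0.
Qed.

(** Reading off the coefficients inside the box is linear on all polynomials, but injective only on
    those that fit into the box. *)
Lemma mdeg_le_encode n d : exists enc : mpoly k n -> 'rV[k]_(d.+1 ^ n),
  (forall c u v, enc (mconst n c * u + v) = c *: enc u + enc v) /\
  (forall u, mdeg_le d u -> enc u = 0 -> u = 0).
Proof.
elim: n => [|n [enc [encD enc0]]].
  exists (fun u => const_mx u); split=> [c u v|u _ /rowP/(_ 0)]; last by rewrite !mxE.
  by apply/rowP=> i; rewrite !mxE.
rewrite expnS; exists (fun u : {poly mpoly k n} => mxvec (\matrix_(i < d.+1) enc u`_i)).
split=> [c u v|u [su du] u0] /=.
  rewrite -linearP; congr mxvec; apply/row_matrixP=> i.
  by rewrite linearD linearZ /= !rowK coefD coefCM encD.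
apply/polyP=> i; rewrite coef0; have [di|di] := ltnP i d.+1; last first.
  by rewrite nth_default // (leq_trans su).
apply: enc0 (du i) _; move: u0; rewrite -(linear0 mxvec) => /(can_inj mxvecK).
by move/row_matrixP/(_ (Ordinal di)); rewrite rowK row0.
Qed.

(* Polynomials of degree at most d in each of n+1 variables form a space of
   dimension (d+1)^(n+1), which eventually exceeds the dimension O(d^n) of a
   space containing their values. *)
Lemma meval_dependent n (fs : nat -> mpoly k n) :
  exists2 w : mpoly k n.+1, w != 0 & meval fs w = 0.
Proof.
have [e eP] : exists e, forall i, (i < n.+1)%N -> mdeg_le e (fs i).
  have /choice[e eP] : forall i, exists e, mdeg_le e (fs i) by move=> i; apply: mdeg_le_ex.
  exists (\max_(i < n.+1) e i) => i lin; apply: mdeg_leW (eP i).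
  exact: (leq_bigmax (Ordinal lin)).
(* Chosen so that [M.+1 <= c * d.+1], whence [M.+1 ^ n <= c ^ n * d.+1 ^ n = d * d.+1 ^ n < d.+1 ^
   n.+1]. *)
pose c := (n.+1 * e).+1; pose d := (c ^ n)%N; pose M := (n.+1 * (d * e))%N.
have [dec [decD dec0 decd]] := mdeg_le_decode n.+1 d.
have [enc [encD enc0]] := mdeg_le_encode n M.
have [||v v0 vE] := @linear_kernel k _ _ (fun v => enc (meval fs (dec v))).
- move=> x u v; rewrite -encD -(meval_const n.+1 fs) decD.
  by rewrite -[in RHS]rmorphM -[in RHS]rmorphD.
- have Mc : (M.+1 <= c * d.+1)%N by rewrite /M /c; nia.
  apply: (@leq_ltn_trans ((c * d.+1) ^ n)); first by case: (n) => // n'; rewrite leq_exp2r.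
  by rewrite expnMn expnS ltn_pmul2r ?expn_gt0.
exists (dec v); first by apply: contraNneq v0 => /dec0 ->.
by apply: enc0 => //; apply: mdeg_le_meval.
Qed.

(** Adjoining [g] as an extra member gives a relation. Its part free of the last variable is a
    relation modulo [g]; if that part is zero, the last variable is divided out, as [g] is
    nonzero. *)
Lemma meval_dependent_mod n (fs : nat -> mpoly k n) (g : mpoly k n) : g != 0 ->
  exists2 w : mpoly k n, w != 0 & rdvd g (meval fs w).
Proof.
move=> g0; pose gs i := if i == n then g else fs i.
have [w w0 wE] := meval_dependent gs.
elim/poly_ind: (w : {poly mpoly k n}) w0 wE => {w} [|v c IHv]; first by rewrite eqxx.
have -> : meval gs (v * 'X + c%:P : mpoly k n.+1) = meval (m := n.+1) gs v * g + meval fs c.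
  rewrite meval_MXaddC {2}/gs eqxx; congr (_ + _); apply: eq_meval => i lin.
  by rewrite /gs ltn_eqF.
have [->|c0 _ vE] := eqVneq c 0.
  rewrite addr0 rmorph0 addr0 => v0 /eqP; rewrite mulf_eq0 (negPf g0) orbF => /eqP vE.
  by apply: IHv vE; apply: contraNneq v0 => ->; rewrite mul0r.
exists c => //; exists (- meval (m := n.+1) gs v).
by apply/eqP; rewrite mulNr -addr_eq0 addrC vE.
Qed.

End AlgebraicDependence.

(** * The residue field of a prime element *)

Section ResidueField.

Variables (R : idomainType) (g : R).
Hypothesis gP : prime_elt g.

Definition principal_ideal : {pred R} := fun a => `[< rdvd g a >].

Lemma principal_idealP a : reflect (rdvd g a) (a \in principal_ideal).
Proof. exact: asboolP. Qed.

Lemma principal_ideal_closed : idealr_closed principal_ideal.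
Proof.
split=> [||a b c]; first by apply/principal_idealP/rdvd0.
  by case: gP => _ ug _; apply/principal_idealP => /rdvd_unit/(_ (unitr1 _)); rewrite (negPf ug).
move=> /principal_idealP gb /principal_idealP gc.
by apply/principal_idealP/rdvdD => //; apply: rdvd_mull.
Qed.

Lemma principal_ideal_prime : prime_idealr_closed principal_ideal.
Proof.
case: gP => _ _ gM a b /principal_idealP/gM[] h; apply/orP; [left|right];
  exact/principal_idealP.
Qed.

HB.instance Definition _ := isIdealr.Build R principal_ideal principal_ideal_closed.
HB.instance Definition _ := isPrimeIdealrClosed.Build R principal_ideal principal_ideal_prime.

Definition residue_ring := {ideal_quot principal_ideal}.
HB.instance Definition _ := GRing.ComNzRing.on residue_ring.

Implicit Type x : residue_ring.

(** Inverses are chosen classically, to give the quotient domain the unit-ring structure required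
    for its fraction field. *)
Definition residue_unit : pred residue_ring := fun x => `[< exists y, y * x = 1 >].

Definition residue_inv x : residue_ring :=
  if pselect (exists y, y * x = 1) is left ex then projT1 (cid ex) else x.

Lemma residue_mulVr : {in residue_unit, left_inverse 1 residue_inv *%R}.
Proof.
move=> x /asboolP ex; rewrite /residue_inv; case: pselect => // ex'.
by case: cid.
Qed.

Lemma residue_unitP x y : y * x = 1 -> residue_unit x.
Proof. by move=> xy; apply/asboolP; exists y. Qed.

Lemma residue_invr_out : {in [predC residue_unit], residue_inv =1 id}.
Proof.
by move=> x /asboolPn nex; rewrite /residue_inv; case: pselect.
Qed.

HB.instance Definition _ := GRing.ComNzRing_hasMulInverse.Build residue_ring
  residue_mulVr residue_unitP residue_invr_out.

HB.instance Definition _ := GRing.ComUnitRing_isIntegral.Build residue_ring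
  (@Quotient.rquot_IdomainAxiom R principal_ideal).

(** The later arguments see [L] only through this description of the kernel of [phi]. *)
Lemma residue_field : exists (L : fieldType) (phi : {rmorphism R -> L}),
  forall a, phi a = 0 <-> rdvd g a.
Proof.
exists {fraction residue_ring}.
exists (@tofrac residue_ring \o (\pi_residue_ring)%qT : {rmorphism R -> {fraction residue_ring}}).
have pi0 : (\pi_residue_ring 0)%qT = 0 by rewrite rmorph0.
move=> a; split=> [/eqP|/principal_idealP].
  rewrite /= tofrac_eq0 => /eqP aE; apply/principal_idealP.
  by rewrite -[a]subr0 Quotient.idealrBE; apply/eqP; rewrite pi0.
rewrite -{1}[a]subr0 Quotient.idealrBE => /eqP aE /=.
by rewrite [X in tofrac X]aE pi0 tofrac0.
Qed.

End ResidueField.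

(** * Vanishing derivatives in characteristic zero *)

Lemma natrS_neq0 (k : fieldType) (S : nzRingType) (f : {rmorphism k -> S}) i :
  [pchar k] =i pred0 -> i.+1%:R != 0 :> S.
Proof. by move=> /pcharf0P k0; rewrite -(rmorph_nat f) fmorph_eq0 k0. Qed.

Lemma deriv_eq0_const (k : fieldType) (S : idomainType) (f : {rmorphism k -> S})
    (p : {poly S}) :
  [pchar k] =i pred0 -> p^`() = 0 -> p = (p`_0)%:P.
Proof.
move=> k0 p'0; apply/polyP=> -[|i]; rewrite coefC //=.
have /eqP : p^`()`_i = 0 by rewrite p'0 coef0.
rewrite coef_deriv -mulr_natr mulf_eq0 (negPf (natrS_neq0 f i k0)) orbF.
by move/eqP.
Qed.

Lemma mpoly_unit_const (k : fieldType) n (u : mpoly k n) :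
  u \is a GRing.unit -> exists c, u = mconst n c.
Proof.
elim: n u => [|n IHn] u; first by exists u.
rewrite [_ \is a _]poly_unitE => /andP[/eqP su /IHn[c cE]]; exists c.
by rewrite [u]size1_polyC ?su //= cE.
Qed.

Lemma mconst_unit (k : fieldType) n c :
  (mconst n c : mpoly k n) != 0 -> (mconst n c : mpoly k n) \is a GRing.unit.
Proof. by rewrite fmorph_eq0 => c0; rewrite rmorph_unit ?unitfE. Qed.

(** The derivative in the last variable has smaller degree, so divisibility by [p] makes it zero.
    Hence [p] is free of that variable, and the argument repeats one ring below. *)
Lemma rdvd_mderiv_unit (k : fieldType) m (p : mpoly k m) :
  [pchar k] =i pred0 -> p != 0 -> (forall a, (a < m)%N -> rdvd p (mderiv a p)) ->
  p \is a GRing.unit.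
Proof.
move=> k0; elim: m p => [|m IHm] p p0 pd; first by rewrite unitfE.
have pE : p = ((p : {poly mpoly k m})`_0)%:P.
  apply: (deriv_eq0_const (@mconst k m)) => //; apply: contrapT => /eqP p'0.
  have [c] := pd m (ltnSn m); rewrite mderiv_last => cE.
  have c0 : c != 0 by apply: contraNneq p'0 => c0; rewrite cE c0 mul0r.
  have := lt_size_deriv p0; rewrite cE mulrC ltnNge => /negP; apply.
  by apply: leq_trans (dvdp_leq _ (dvdp_mulr _ (dvdpp _))); rewrite ?mulf_neq0.
move: p0 pd; rewrite pE; move: {p pE}(p : {poly mpoly k m})`_0 => p.
rewrite polyC_eq0 => p0 pd; rewrite [_ \is a _]polyC_unitE; apply: IHm => // a am.
have := pd a (ltnW am); rewrite mderiv_coef // map_polyC => /(rdvd_polyC _ _).2/(_ 0%N).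
by rewrite coefC.
Qed.

(** * Gradients over the residue field and algebraic independence *)

Section Gradient.

Variables (k : fieldType) (n : nat) (L : fieldType) (phi : {rmorphism mpoly k n -> L}).
Variable g : mpoly k n.
Hypothesis k0 : [pchar k] =i pred0.
Hypothesis g0 : g != 0.
Hypothesis phiP : forall a, phi a = 0 <-> rdvd g a.
Implicit Types (fs gs : nat -> mpoly k n).

Definition grad (a : mpoly k n) : 'rV[L]_n := \row_i phi (mderiv i a).

Lemma gradM a b : grad (a * b) = phi b *: grad a + phi a *: grad b.
Proof.
by apply/rowP=> i; rewrite !mxE mderivM rmorphD !rmorphM mulrC.
Qed.

Lemma grad_meval m fs (w : mpoly k m) :
  grad (meval fs w) = \sum_(a < m) phi (meval fs (mderiv a w)) *: grad (fs a).
Proof.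
apply/rowP=> i; rewrite !mxE mderiv_meval rmorph_sum summxE.
by apply: eq_bigr => a _; rewrite !mxE rmorphM.
Qed.

Lemma phig : phi g = 0.
Proof. exact/phiP/rdvdxx. Qed.

Lemma grad_mulg h : grad (h * g) = phi h *: grad g.
Proof. by rewrite gradM phig scale0r add0r. Qed.

Lemma grad_mX (i : 'I_n) : grad (mX k n i) = delta_mx 0 i.
Proof.
by apply/rowP=> j; rewrite !mxE mderiv_mX // rmorph_nat.
Qed.

(** The row [grad g] is included because the gradient of a residue class modulo [g] is well defined
    only up to its multiples. *)
Fixpoint grad_span m fs : 'M[L]_n :=
  if m is m'.+1 then (grad_span m' fs + grad (fs m'))%MS else <<grad g>>%MS.

Lemma eq_grad_span m fs gs :
  (forall i, (i < m)%N -> fs i = gs i) -> grad_span m fs = grad_span m gs.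
Proof.
elim: m => //= m IHm fg; rewrite IHm ?fg // => i im; apply: fg; exact: ltnW.
Qed.

Lemma grad_span_g m fs : (grad g <= grad_span m fs)%MS.
Proof.
by elim: m => [|m IHm] /=; [rewrite genmxE|apply: submx_trans IHm (addsmxSl _ _)].
Qed.

Lemma grad_span_sub m d fs : (grad_span m fs <= grad_span (m + d) fs)%MS.
Proof.
elim: d => [|d IHd]; first by rewrite addn0.
by rewrite addnS /=; apply: submx_trans IHd (addsmxSl _ _).
Qed.

Lemma grad_span_grad m fs i : (i < m)%N -> (grad (fs i) <= grad_span m fs)%MS.
Proof.
move=> im; rewrite -(subnKC im); apply: submx_trans (grad_span_sub _ _ _).
exact: addsmxSr.
Qed.

Lemma grad_span_minP m fs p (A : 'M[L]_(p, n)) :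
  (grad g <= A)%MS -> (forall i, (i < m)%N -> (grad (fs i) <= A)%MS) ->
  (grad_span m fs <= A)%MS.
Proof.
move=> gA; elim: m => [|m IHm] fA /=; first by rewrite genmxE.
by rewrite addsmx_sub IHm ?fA // => i im; apply: fA; apply: ltnW.
Qed.

Lemma rank_grad_spanD m d fs : (\rank (grad_span (m + d) fs) <= \rank (grad_span m fs) + d)%N.
Proof.
elim: d => [|d IHd]; first by rewrite !addn0.
rewrite !addnS /=; apply: leq_trans (mxrank_adds_leqif _ _).1 _.
by rewrite -[leqRHS]addn1 leq_add // rank_leq_row.
Qed.

Lemma rank_grad_span m fs : (\rank (grad_span m fs) <= m.+1)%N.
Proof.
apply: leq_trans (rank_grad_spanD 0 m fs) _.
by rewrite /= -[leqRHS]add1n leq_add2r genmxE rank_leq_row.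
Qed.

(* Algebraic independence modulo [g], the kernel of [phi]. *)
Definition independent m fs := forall w : mpoly k m, phi (meval fs w) = 0 -> w = 0.

Lemma eq_independent m fs gs :
  (forall i, (i < m)%N -> fs i = gs i) -> independent m fs -> independent m gs.
Proof. by move=> fg indf w; rewrite -(eq_meval fg) => /indf. Qed.

Lemma independentW m fs : independent m.+1 fs -> independent m fs.
Proof.
by move=> indf w; rewrite -meval_polyC => /indf/eqP; rewrite polyC_eq0 => /eqP.
Qed.

(** This bounds the transcendence degree: any [n] members are dependent modulo [g]. *)
Lemma independent_lt m fs : independent m fs -> (m < n)%N.
Proof.
move=> indf; rewrite ltnNge; apply/negP=> nm.
have {m nm}indf : independent n fs.
  by move: indf; rewrite -(subnKC nm); elim: (m - n)%N => [|d IHd];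
    rewrite ?addn0 // addnS => /independentW.
have [w w0 /phiP/indf wE] := meval_dependent_mod fs g0.
by rewrite wE eqxx in w0.
Qed.

(* Replacing a relation by its derivative as long as the latter is still a
   relation ends with a separable one. *)
Lemma separable_relation m fs (q : {poly mpoly k m}) i :
  phi (meval (m := m.+1) fs q) = 0 -> phi (meval fs q`_i) != 0 ->
  exists2 q' : {poly mpoly k m}, phi (meval (m := m.+1) fs q') = 0
    & phi (meval (m := m.+1) fs q'^`()) != 0.
Proof.
have [s] := ubnP (size q); elim: s q i => // s IHs q i; rewrite ltnS => sq qE qi.
have [q'E|] := eqVneq (phi (meval (m := m.+1) fs q^`())) 0; last by exists q.
have [[j q'j]|nq'] := pselect (exists j, phi (meval fs q^`()`_j) != 0).
  apply: (IHs _ j) q'E q'j; apply: leq_trans sq; apply: lt_size_deriv.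
  by apply: contraNneq qi => ->; rewrite coef0 !rmorph0.
(* Otherwise the image of [q] over [L] has zero derivative, so it is constant; its root makes it
   zero, against the nonzero coefficient at [i]. *)
have Q (v : {poly mpoly k m}) :
    phi (meval (m := m.+1) fs v) = (map_poly (phi \o @meval k n m fs) v).[phi (fs m)].
  by rewrite map_poly_comp horner_map.
have Q'0 : (map_poly (phi \o @meval k n m fs) q)^`() = 0.
  rewrite deriv_map; apply/polyP=> j; rewrite coef_map coef0 /=; apply/eqP.
  by apply: contra_notT nq' => q'j; exists j.
have QC := deriv_eq0_const (phi \o @mconst k n) k0 Q'0.
move: qE; rewrite Q QC hornerC => q0; case/eqP: qi.
by have := coef_map (phi \o @meval k n m fs) q i; rewrite QC q0 coef0.
Qed.

(** The hypotheses say that [fs m] is algebraic over the earlier members. The chain rule for a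
    separable relation is solved for [grad (fs m)], whose coefficient is nonzero. *)
Lemma grad_algebraic m fs (q : {poly mpoly k m}) i :
  phi (meval (m := m.+1) fs q) = 0 -> phi (meval fs q`_i) != 0 ->
  (grad (fs m) <= grad_span m fs)%MS.
Proof.
move=> qE qi; have [q' /phiP[h hE] q'0] := separable_relation qE qi.
have := grad_meval (m := m.+1) fs q'; rewrite hE grad_mulg big_ord_recr => gE.
set c := phi _ in q'0; set S := \sum_(_ < _) _ in gE.
have -> : grad (fs m) = c^-1 *: (phi h *: grad g - S).
  by rewrite gE addrC addKr /= eqxx scalerA mulVf // scale1r.
apply: scalemx_sub; apply: addmx_sub; first by apply: scalemx_sub; apply: grad_span_g.
rewrite eqmx_opp; apply: summx_sub => a _; apply: scalemx_sub.
exact: grad_span_grad (ltn_ord a).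
Qed.

Lemma independent_last m fs :
  independent m fs -> ~ independent m.+1 fs -> (grad (fs m) <= grad_span m fs)%MS.
Proof.
move=> indf nindf; apply: contrapT => ngf; apply: nindf => q qE; apply/eqP/negPn/negP=> q0.
apply: ngf; apply: grad_algebraic qE (_ : phi (meval fs (lead_coef (q : {poly mpoly k m}))) != 0).
by apply: contraNneq q0 => /indf/eqP; rewrite lead_coef_eq0.
Qed.

(** Greedy choice: each [xs j] is adjoined if independence survives; otherwise it is algebraic over
    the family, and its gradient already lies in the span. *)
Lemma independent_extend (xs : nat -> mpoly k n) N m fs : independent m fs ->
  exists d fs', [/\ forall i, (i < m)%N -> fs' i = fs i, independent (m + d) fs'
    & forall j, (j < N)%N -> (grad (xs j) <= grad_span (m + d) fs')%MS].
Proof.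
move=> indf; elim: N => [|N [d [fs' [fsE indf' spn]]]].
  by exists 0%N, fs; rewrite addn0; split.
pose fs2 i := if i == (m + d)%N then xs N else fs' i.
have fs2E i : (i < m + d)%N -> fs' i = fs2 i by move=> im; rewrite /fs2 ltn_eqF.
have ind2 : independent (m + d) fs2 by apply: eq_independent indf'.
have [ind3|nind3] := pselect (independent (m + d).+1 fs2).
  exists d.+1, fs2; rewrite addnS; split=> // [i im|j].
    by rewrite -fs2E ?fsE // ltn_addr.
  rewrite ltnS leq_eqVlt => /predU1P[->|jN] /=.
    by rewrite {2}/fs2 eqxx addsmxSr.
  by rewrite -(eq_grad_span fs2E); apply: submx_trans (spn j jN) (addsmxSl _ _).
exists d, fs'; split=> // j; rewrite ltnS leq_eqVlt => /predU1P[->|]; last exact: spn.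
have := independent_last ind2 nind3; rewrite {1}/fs2 eqxx.
by rewrite -(eq_grad_span fs2E).
Qed.

(** Extended by [d] variables, the span has rank [n], which is at least [m + d + 1]. Each adjoined
    row raises the rank by at most one, so [m + 1] remains for the original family. *)
Lemma independent_rank m fs : independent m fs -> \rank (grad_span m fs) = m.+1.
Proof.
move=> indf; apply/eqP; rewrite eqn_leq rank_grad_span /=.
have [d [fs' [fsE indf' spn]]] := independent_extend (mX k n) n indf.
rewrite -(eq_grad_span fsE) -(leq_add2r d) addSn.
apply: leq_trans (rank_grad_spanD m d fs').
apply: leq_trans (independent_lt indf') _.
rewrite -{1}(mxrank1 L n); apply: mxrankS; apply/row_subP=> i.
by rewrite rowE mulmx1 -grad_mX; apply: spn.
Qed.

End Gradient.

(** * The prime ideal of relations modulo [g], principal or not *)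

Section Relations.

Variables (k : fieldType) (n : nat) (L : fieldType) (phi : {rmorphism mpoly k n -> L}).
Variable g : mpoly k n.
Hypothesis k0 : [pchar k] =i pred0.
Hypothesis g0 : g != 0.
Hypothesis phiP : forall a, phi a = 0 <-> rdvd g a.
Implicit Types (fs gs : nat -> mpoly k n).

(** Membership in the ideal [P] of the overview. *)
Definition relation m fs (w : mpoly k m) := phi (meval fs w) = 0.

Lemma relation_rdvd m fs (p w : mpoly k m) : relation fs p -> rdvd p w -> relation fs w.
Proof. by rewrite /relation => pE [c ->]; rewrite !rmorphM /= pE mulr0. Qed.

Lemma relation_nonunit m fs (w : mpoly k m) : relation fs w -> w \isn't a GRing.unit.
Proof.
move=> wE; apply/negP => /(rmorph_unit (phi \o @meval k n m fs)) /=.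
by rewrite [phi _]wE unitr0.
Qed.

Lemma relation_polyC m fs (c : mpoly k m) :
  relation (m := m.+1) fs c%:P <-> relation fs c.
Proof. by rewrite /relation meval_polyC. Qed.

Lemma relation_prime_factor m fs (w : mpoly k m) : w != 0 -> relation fs w ->
  exists p, [/\ prime_elt p, relation fs p & rdvd p w].
Proof.
move=> w0; elim/(factorial_ind (@mpoly_factorial k m)): w / w0 =>
  [u uu /relation_nonunit|p a pP a0 IHa].
  by rewrite uu.
rewrite /relation !rmorphM => /eqP; rewrite mulf_eq0 => /orP[/eqP pE|/eqP /IHa[q [qP qE qa]]].
  by exists p; split=> //; apply/rdvd_mulr/rdvdxx.
by exists q; split=> //; apply: rdvd_mull.
Qed.

(** Eliminating the last variable between [p] and [q] gives a nonzero relation free of it; as [P] is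
    prime, one of its prime factors is a relation. *)
Lemma relation_elimination m fs (p q : mpoly k m.+1) :
  irreducible_elt p -> relation fs p -> relation fs q -> ~ rdvd p q ->
  exists c : mpoly k m, prime_elt c /\ relation fs c.
Proof.
move=> irrp pE qE npq.
have [r [u [v [r0 rE]]]] := irreducible_elimination (@mpoly_factorial k m) irrp npq.
have /relation_polyC : relation (m := m.+1) fs r%:P.
  rewrite rE /relation rmorphD rmorphM [X in _ + X]rmorphM rmorphD !rmorphM.
  by rewrite [phi (meval fs p)]pE [phi (meval fs q)]qE !mulr0 addr0.
by case/(relation_prime_factor r0) => c [cP cE _]; exists c.
Qed.

Lemma rank_grad_span_dependent m fs :
  ~ independent phi m fs -> (\rank (grad_span phi g m fs) <= m)%N.
Proof.
elim: m => [|m IHm] nind.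
  case: nind => c /(@relation_nonunit 0); rewrite unitfE negbK => /eqP; exact.
have [indf|/IHm rm] := pselect (independent phi m fs); last first.
  have := rank_grad_spanD phi g m 1 fs; rewrite addn1 => /leq_trans; apply.
  by rewrite addn1 ltnS.
have gm := independent_last k0 phiP indf nind.
by apply: leq_trans (rank_grad_span phi g m fs); rewrite mxrankS //= addsmx_sub gm submx_refl.
Qed.

(** The rank drops two below its maximum [m + 1]. If the last member is algebraic over the others,
    it adds nothing to the rank, and the others are dependent through [c]. If not, coefficients of
    relations are relations; these cannot all be multiples of [c], or else [p] would be associated
    to [c] and divide [q]. So induction applies to the first members. *)
Lemma rank_grad_span_nonprincipal m fs (p q : mpoly k m) :
  irreducible_elt p -> relation fs p -> relation fs q -> ~ rdvd p q ->
  (\rank (grad_span phi g m fs) < m)%N.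
Proof.
elim: m p q => [|m IHm] p q irrp pE qE npq.
  by case: irrp => p0 _; have := relation_nonunit pE; rewrite unitfE p0.
have [c [cP cE]] := relation_elimination irrp pE qE npq.
have rS : (\rank (grad_span phi g m.+1 fs) <= (\rank (grad_span phi g m fs)).+1)%N.
  by have := rank_grad_spanD phi g m 1 fs; rewrite !addn1.
have [[v [i [vE vi]]]|nalg] :=
    pselect (exists (v : {poly mpoly k m}) i, relation (m := m.+1) fs v /\ ~ relation fs v`_i).
  have gm := grad_algebraic k0 phiP vE (introN eqP vi).
  apply: (@leq_ltn_trans (\rank (grad_span phi g m fs))).
    by rewrite mxrankS //= addsmx_sub gm submx_refl.
  rewrite ltnS; apply: rank_grad_span_dependent => indf.
  by have [c0 _ _] := cP; rewrite (indf c cE) eqxx in c0.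
have coefE (v : {poly mpoly k m}) i : relation (m := m.+1) fs v -> relation fs v`_i.
  by move=> vE; apply: contrapT => vi; apply: nalg; exists v, i.
have [[d [dE ncd]]|princ] := pselect (exists d, relation fs d /\ ~ rdvd c d).
  by apply: leq_ltn_trans rS _; rewrite ltnS; apply: IHm (prime_irreducible cP) cE dE ncd.
have cdvd (v : {poly mpoly k m}) : relation (m := m.+1) fs v -> rdvd c%:P v.
  move=> vE; apply/rdvd_polyC=> i; apply: contrapT => ncv.
  by apply: princ; exists v`_i; split=> //; apply: coefE.
have [_ ucP _] := prime_polyC cP.
by case: npq; apply: rdvd_trans (cdvd _ qE); apply: irreducible_rdvd_sym (cdvd _ pE).
Qed.

(** One omits the last variable that occurs in the generator [p]: every nonzero multiple of [p]
    involves it. The map [sigma] renames variables, so that relations of [gs] become relations of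
    [fs]. *)
Lemma principal_independent_subfamily m fs (p : mpoly k m) :
  p != 0 -> relation fs p -> (forall w, relation fs w -> rdvd p w) ->
  exists r gs (sigma : mpoly k r -> mpoly k m),
    [/\ r.+1 = m, independent phi r gs, forall w, meval fs (sigma w) = meval gs w
      & forall i, (i < r)%N -> exists2 j, (j < m)%N & gs i = fs j].
Proof.
elim: m p => [|m IHm] p p0 pE princ.
  by have := relation_nonunit pE; rewrite unitfE p0.
have [sp|sp] := ltnP 1 (size (p : {poly mpoly k m})).
  exists m, fs, (fun w => w%:P : mpoly k m.+1); split=> // [w|w|i im]; last first.
  - by exists i => //; apply: ltnW.
  - exact: meval_polyC.
  move/(relation_polyC fs w).2/princ => -[c cE]; apply: contrapT => /eqP w0.
  have c0 : c != 0 by apply: contraNneq w0 => c0; rewrite -polyC_eq0 cE c0 mul0r.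
  have : (size (w%:P : {poly mpoly k m}) <= 1)%N by rewrite size_polyC; case: (_ != 0).
  rewrite cE leqNgt => /negP; apply; apply: leq_trans sp _.
  apply: dvdp_leq; first by rewrite mulf_neq0.
  exact: dvdp_mull.
move: p0 pE princ; rewrite [p]size1_polyC //.
move: {p sp}(p : {poly mpoly k m})`_0 => p; rewrite polyC_eq0 => p0 /relation_polyC pE princ.
have [w wE|r [gs [sigma [rm indg sE gsE]]]] := IHm p p0 pE.
  by have /(rdvd_polyC _ _).2/(_ 0%N) := princ _ ((relation_polyC fs w).2 wE); rewrite coefC.
pose gs' i := if i == r then fs m else gs i.
have gsE' w : meval gs w = meval gs' (w : mpoly k r).
  by apply: eq_meval => i ir; rewrite /gs' ltn_eqF.
pose sigma' (w : {poly mpoly k r}) : {poly mpoly k m} := \poly_(i < size w) sigma w`_i.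
have sE' w : meval (m := m.+1) fs (sigma' w) = meval (m := r.+1) gs' w.
  rewrite (meval_wide fs (size_poly _ _ : (size (sigma' w) <= size w)%N)).
  rewrite (meval_wide gs' (leqnn (size w))) {2}/gs' eqxx.
  by apply: eq_bigr => i _; rewrite coef_poly ltn_ord sE gsE'.
exists r.+1, gs', sigma'; split=> //; first by rewrite rm.
  move=> w; rewrite -sE' => wE; apply/polyP=> i; rewrite coef0.
  have [iw|iw] := ltnP i (size (w : {poly mpoly k r})); last by rewrite nth_default.
  (* Here [p] is free of the last variable, so it divides each coefficient of [sigma' w]; these are
     then relations, and independence of [gs] kills the coefficients of [w]. *)
  have /(rdvd_polyC _ _).2/(_ i) := princ _ wE; rewrite coef_poly iw => /(relation_rdvd pE).
  by rewrite /relation sE => /indg.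
move=> i; rewrite ltnS leq_eqVlt /gs' => /predU1P[->|ir]; first by exists m; rewrite ?eqxx.
have [j jm ->] := gsE i ir; exists j; first exact: ltnW.
by rewrite ltn_eqF.
Qed.

Definition jacobian m fs : 'M[L]_(m, n) := \matrix_(a < m) grad phi (fs a).

Lemma jacobian_grad m fs i : (i < m)%N -> (grad phi (fs i) <= jacobian m fs)%MS.
Proof. by move=> im; have := row_sub (Ordinal im) (jacobian m fs); rewrite rowK. Qed.

Lemma jacobian_grad_span m fs : (jacobian m fs <= grad_span phi g m fs)%MS.
Proof. by apply/row_subP=> i; rewrite rowK; apply: grad_span_grad. Qed.

(** Both summands of the Eisenstein combination carry the square of a relation, [c] or [d], so their
    values are divisible by [g ^+ 2]. *)
Lemma nonprincipal_square m fs (p q : mpoly k m) :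
  irreducible_elt p -> relation fs p -> relation fs q -> ~ rdvd p q ->
  exists w : mpoly k m, irreducible_elt w /\ rdvd (g ^+ 2) (meval fs w).
Proof.
case: m p q => [|m] p q irrp pE qE npq.
  by case: irrp => p0 _; have := relation_nonunit pE; rewrite unitfE p0.
have [c [cP cE]] := relation_elimination irrp pE qE npq; have [c0 uc _] := cP.
have [_ ucP _] := prime_polyC cP.
(* One of [p] and [q] serves: if [c] divided both, [p] would be associated to [c] and would divide
   [q]. *)
have [d [dE ncd]] : exists d : {poly mpoly k m}, relation (m := m.+1) fs d /\ ~ rdvd c%:P d.
  have [cp|ncp] := pselect (rdvd c%:P p); last by exists p.
  have [cq|ncq] := pselect (rdvd c%:P q); last by exists q.
  by case: npq; apply: rdvd_trans cq; apply: irreducible_rdvd_sym cp.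
have [l lP lc] : exists2 l, prime_elt l & rdvd l (1 + c).
  apply: (prime_factor (@mpoly_factorial k m)).
    apply: contraNneq uc => /eqP; rewrite addrC addr_eq0 => /eqP->.
    by rewrite unitrN unitr1.
  (* A unit [1 + c] is constant, which makes [c] a nonzero constant, hence a unit. *)
  apply: contraNN uc => /mpoly_unit_const[x xE].
  have cx : c = mconst m (x - 1) by rewrite rmorphB rmorph1 /= -xE addrC addKr.
  by rewrite cx mconst_unit // -cx.
have irrw := eisenstein_combination_irreducible (@mpoly_factorial k m) cP lP lc ncd.
set w := _ + _ in irrw; exists w; split=> //.
have sq (v a : mpoly k m.+1) : relation fs v -> rdvd (g ^+ 2) (meval fs (v ^+ 2 * a)).
  move=> /phiP[h hE].
  have -> : meval fs (v ^+ 2 * a) = meval fs v ^+ 2 * meval fs a by rewrite rmorphM rmorphXn.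
  by rewrite hE exprMn; apply/rdvd_mulr/rdvd_mull/rdvdxx.
rewrite [w]/(_ + _ : {poly mpoly k m}) rmorphD; apply: rdvdD.
  by rewrite rmorphXn; apply/sq/relation_polyC.
by rewrite mulrA mulrC; apply: sq.
Qed.

Lemma exists_irreducible_square m fs : (\rank (jacobian m fs) < m)%N ->
  exists w : mpoly k m, irreducible_elt w /\ rdvd (g ^+ 2) (meval fs w).
Proof.
(* Independence is impossible: the span would have rank [m + 1], yet [grad g] adds at most one to
   the rank of the Jacobian matrix. *)
move=> rJ; have [indf|/existsNP[v /not_implyP[vE /eqP v0]]] := pselect (independent phi m fs).
  have := independent_rank k0 g0 phiP indf.
  have : (grad_span phi g m fs <= grad phi g + jacobian m fs)%MS.
    apply: grad_span_minP => [|i im]; first exact: addsmxSl.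
    exact: submx_trans (jacobian_grad _ im) (addsmxSr _ _).
  move/mxrankS/leq_trans/(_ (mxrank_adds_leqif _ _).1) => rS rE.
  move: rS; rewrite rE => /leq_trans/(_ (leq_add (rank_leq_row _) (leqnn _))).
  by rewrite add1n ltnS leqNgt rJ.
have [p [pP pE _]] := relation_prime_factor v0 vE.
have irrp := prime_irreducible pP.
have [[q [qE npq]]|princ] := pselect (exists q, relation fs q /\ ~ rdvd p q).
  exact: nonprincipal_square irrp pE qE npq.
exists p; split=> //; have /phiP[h hE] := pE.
have [/phiP[h' h'E]|/eqP ph] := pselect (phi h = 0).
  by exists h'; rewrite hE h'E; ring.
have [|r [gs [sigma [rm indg _ gsE]]]] := principal_independent_subfamily (irrp.1) pE.
  by move=> w wE; apply: contrapT => npw; apply: princ; exists w.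
(* With [phi h] nonzero, differentiating [p(fs) = h g] puts [grad g] in the row space. Together with
   the [m - 1] independent members it forces rank [m]. *)
have gJ : (grad phi g <= jacobian m fs)%MS.
  rewrite -(scale1r (grad phi g)) -(mulVf ph) -scalerA -(grad_mulg phiP) -hE grad_meval.
  apply/scalemx_sub/summx_sub => a _; apply/scalemx_sub; exact: jacobian_grad.
have : (grad_span phi g r gs <= jacobian m fs)%MS.
  apply: grad_span_minP => // i ir; have [j jm ->] := gsE i ir; exact: jacobian_grad.
by move/mxrankS; rewrite (independent_rank k0 g0 phiP indg) rm leqNgt rJ.
Qed.

Lemma squarefree_square_jacobian m fs (w : mpoly k m) :
  squarefree_elt w -> rdvd (g ^+ 2) (meval fs w) -> (\rank (jacobian m fs) < m)%N.
Proof.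
move=> sfw [h hE]; rewrite ltn_neqAle rank_leq_row andbT; apply/negP => frJ.
have w0 : w != 0.
  by apply/eqP=> w0; apply: sfw; exists 0, 0; rewrite mulr0 unitr0.
have wE : relation fs w.
  by apply/phiP; rewrite hE expr2 mulrA; apply/rdvd_mull/rdvdxx.
(* The gradient of a multiple of [g ^+ 2] vanishes in [L]; the chain rule turns this into a linear
   relation between independent rows. *)
have dE a : (a < m)%N -> relation fs (mderiv a w).
  move=> am; pose u : 'rV[L]_m := \row_b phi (meval fs (mderiv b w)).
  have : u *m jacobian m fs = 0.
    rewrite mulmx_sum_row.
    transitivity (grad phi (meval fs w)).
      by rewrite grad_meval; apply: eq_bigr => b _; rewrite mxE rowK.
    by rewrite hE expr2 mulrA (grad_mulg phiP) rmorphM (phig phiP) mulr0 scale0r.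
  rewrite -(mul0mx _ (jacobian m fs)) => /(row_free_inj frJ)/rowP/(_ (Ordinal am)).
  by rewrite !mxE.
have [p [pP pE [w' w'E]]] := relation_prime_factor w0 wE; have [p0 up pM] := pP.
have princ v : relation fs v -> rdvd p v.
  move=> vE; apply: contrapT => npv.
  have := rank_grad_span_nonprincipal (prime_irreducible pP) pE vE npv.
  by rewrite ltnNge; move: (mxrankS (jacobian_grad_span m fs)); rewrite (eqP frJ) => ->.
have [[x xE]|npw'] := pselect (rdvd p w').
  by apply: sfw; exists p, x; split=> //; rewrite w'E xE; ring.
case/negP: up; apply: rdvd_mderiv_unit k0 p0 _ => a am.
(* Product rule for [w = w' * p]. As [p] does not divide [w'], it would divide all its own partial
   derivatives and be a unit. *)
have : rdvd p (w' * mderiv a p).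
  have := princ _ (dE a am); rewrite w'E mderivM => pd.
  rewrite -[X in rdvd _ X](addKr (mderiv a w' * p)); apply: rdvdD pd.
  by apply/rdvdN/rdvd_mull/rdvdxx.
by case/pM.
Qed.

End Relations.

(** * Maximal minors, rank and the equivalences *)

Lemma rank_increasing_minor (F : fieldType) m n (A : 'M[F]_(m, n)) : \rank A = m ->
  exists2 s : 'I_m -> 'I_n, (forall a b : 'I_m, (a < b)%N -> (s a < s b)%N)
    & \det (\matrix_(a < m, b < m) A a (s b)) != 0.
Proof.
move=> rA; have rAT : row_full A^T by rewrite /row_full mxrank_tr rA.
(* [fullrankfun] picks independent columns of [A] in no prescribed order; enumerating its image
   makes the choice increasing. *)
pose f := fullrankfun rAT; pose S := [set f i | i : 'I_m].
have cS : #|S| = m by rewrite card_imset ?card_ord //; apply: fullrankfun_inj.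
pose s (b : 'I_m) : 'I_n := enum_val (cast_ord (esym cS) b).
exists s => [a b ab|].
  have srt : sorted (relpre val ltn) (enum S).
    rewrite /enum_mem; apply: sorted_filter; first by move=> x y z; apply: ltn_trans.
    by rewrite -sorted_map unlock val_ord_enum iota_ltn_sorted.
  rewrite /s !(enum_val_nth (s a)).
  have tr : transitive (relpre (@nat_of_ord n) ltn) by move=> x y z; apply: ltn_trans.
  by apply: (sorted_ltn_nth tr (s a) srt); rewrite ?inE -?cardE //= cS.
have -> : \matrix_(a < m, b < m) A a (s b) = (rowsub s A^T)^T.
  by apply/matrixP=> a b; rewrite !mxE.
rewrite det_tr -unitfE -unitmxE -row_full_unit -col_leq_rank.
rewrite -{1}(mxrank_fullrowsub rAT); apply: mxrankS; apply/row_subP=> i.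
have fS : f i \in S by apply: imset_f.
have -> : row i (rowsub f A^T) = row (cast_ord cS (enum_rank_in fS (f i))) (rowsub s A^T).
  by apply/rowP=> j; rewrite !mxE /s cast_ordK enum_rankK_in.
exact: row_sub.
Qed.

(** [phi] sends a minor to the same minor of the Jacobian matrix over [L]. Selecting columns is a
    right multiplication, so a nonzero minor forces rank [m]. *)
Lemma jac_minor_rank (k : fieldType) n m (f : 'I_m -> mpoly k n) (fs : nat -> mpoly k n)
    (L : fieldType) (phi : {rmorphism mpoly k n -> L}) (g : mpoly k n) :
  (forall a : 'I_m, fs a = f a) -> (forall a, phi a = 0 <-> rdvd g a) ->
  (forall h, is_jac_minor f h -> rdvd g h) <-> (\rank (jacobian phi m fs) < m)%N.
Proof.
move=> fsE phiP; have minorE s : phi (jac_minor f s) =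
    \det (\matrix_(a < m, b < m) jacobian phi m fs a (s b)).
  rewrite -det_map_mx; congr (\det _); apply/matrixP=> a b.
  by rewrite !mxE fsE.
split=> [gJ|rJ h [s [_ ->]]].
  rewrite ltn_neqAle rank_leq_row andbT; apply/eqP => /rank_increasing_minor[s sP].
  by rewrite -minorE => /eqP; apply; apply/phiP/gJ; exists s.
apply/phiP; rewrite minorE; apply/eqP; apply: contraTT rJ.
rewrite -unitfE -unitmxE -row_free_unit -leqNgt => /eqP rs.
rewrite -{1}rs; have -> : \matrix_(a < m, b < m) jacobian phi m fs a (s b) =
    jacobian phi m fs *m colsub s 1%:M.
  apply/matrixP=> a b; rewrite !mxE (bigD1 (s b)) //= !mxE eqxx mulr1 big1 ?addr0 // => j /negPf js.
  by rewrite !mxE js mulr0.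
exact: mxrankM_maxl.
Qed.

Theorem theorem2p3 (k : fieldType) (Hchar : [pchar k] =i pred0)
  (n m : nat) (Hm1 : (1 <= m)%N) (Hmn : (m <= n)%N)
  (f : 'I_m -> mpoly k n) (g : mpoly k n) (Hg : irreducible_elt g) :
  ((exists d, is_dgcd f d /\ rdvd g d) <->
   (exists w : mpoly k m, irreducible_elt w /\ rdvd (g ^+ 2) (mcomp f w))) /\
  ((exists w : mpoly k m, irreducible_elt w /\ rdvd (g ^+ 2) (mcomp f w)) <->
   (exists w : mpoly k m, squarefree_elt w /\ rdvd (g ^+ 2) (mcomp f w))).
Proof.
have [L [phi phiP]] := residue_field (irreducible_prime (@mpoly_factorial k n) Hg).
have g0 := Hg.1; pose fs i := if insub i is Some j then f j else 0.
have fsE (a : 'I_m) : fs a = f a by rewrite /fs valK.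
have JP := jac_minor_rank fsE phiP.
have dgcdP : (exists d, is_dgcd f d /\ rdvd g d) <-> (\rank (jacobian phi m fs) < m)%N.
  rewrite -JP; split=> [[d [[dP _] gd]] h /dP|gJ]; first exact: rdvd_trans.
  (* Increasing maps, coded as finite functions, list the minors in a finite sequence, which has a
     gcd. *)
  pose increasing := [pred s : {ffun 'I_m -> 'I_n} |
    [forall a : 'I_m, forall b : 'I_m, (a < b)%N ==> (s a < s b)%N]].
  pose minors := [seq jac_minor f s | s : {ffun 'I_m -> 'I_n} <- enum increasing].
  have minorsP h : is_jac_minor f h <-> h \in minors.
    split=> [[s [sP ->]]|/mapP[s + ->]].
      apply/mapP; exists (finfun s).
        rewrite mem_enum; apply/forallP=> a; apply/forallP=> b; apply/implyP.
        by rewrite !ffunE; apply: sP.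
      by congr (\det _); apply/matrixP=> a b; rewrite !mxE ffunE.
    rewrite mem_enum => /forallP sP; exists s; split=> // a b ab.
    by have /forallP/(_ b)/implyP := sP a; apply.
  have [d [dP dU]] := factorial_gcd_seq (@mpoly_factorial k n) minors.
  exists d; split; last by apply: dU => h /minorsP/gJ.
  by split=> [h /minorsP/dP|e eP] //; apply: dU => h /minorsP/eP.
have irr_sqf (w : mpoly k m) : irreducible_elt w -> squarefree_elt w.
  case=> w0 [uw wP] [b [c [wE ub]]]; move: (wE); rewrite expr2 -mulrA => /wP[].
    by rewrite (negPf ub).
  by rewrite unitrM (negPf ub).
have sqfP : (exists w : mpoly k m, squarefree_elt w /\ rdvd (g ^+ 2) (mcomp f w)) ->
    (\rank (jacobian phi m fs) < m)%N.
  by case=> w [sfw gw]; apply: (squarefree_square_jacobian Hchar phiP sfw).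
have irrP := exists_irreducible_square Hchar g0 phiP (m := m) (fs := fs).
split; split.
- by move/dgcdP/irrP.
- by case=> w [irrw gw]; apply/dgcdP/sqfP; exists w; split=> //; apply: irr_sqf.
- by case=> w [irrw gw]; exists w; split=> //; apply: irr_sqf.
by move/sqfP/irrP.
Qed.
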